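(* Let $p>1$ and let $\varphi$ be an analytic self-map of $\mathbb{D}$ with $\varphi\in S^p$. Then $D_\varphi:S^p\to S^p$ is compact if and only if $\|\varphi\|_\infty=\sup_{z\in\mathbb{D}}|\varphi(z)|<1$.
   Context: $\mathbb{D}$ is the open unit disk. For $p>1$, $H^p$ is the Hardy space on $\mathbb{D}$ with norm $\|g\|_{H^p}^p=\sup_{0<r<1}\int_0^{2\pi}|g(re^{i\theta})|^p\frac{d\theta}{2\pi}$; $S^p$ is the space of analytic $f$ on $\mathbb{D}$ with $f'\in H^p$, normed by $\|f\|_{S^p}=|f(0)|+\|f'\|_{H^p}$. $D_\varphi f=f'\circ\varphi$. *)

(* Defs.v *)
From Stdlib Require Import Reals ClassicalEpsilon.
From Coquelicot Require Import Coquelicot.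
Open Scope R_scope.

Definition in_disk (z : C) : Prop := Cmod z < 1.

Definition has_cderiv (f : C -> C) (z : C) (l : C) : Prop :=
  @is_derive C_AbsRing C_NormedModule f z l.

Definition analytic_on_disk (f : C -> C) : Prop :=
  forall z, in_disk z -> exists l, has_cderiv f z l.

(* the complex derivative f' (chosen; unique where it exists) *)
Definition cderiv (f : C -> C) (z : C) : C :=
  match excluded_middle_informative (exists l, has_cderiv f z l) with
  | left H => proj1_sig (constructive_indefinite_description _ H)
  | right _ => 0%C
  end.

Definition self_map (phi : C -> C) : Prop :=
  analytic_on_disk phi /\ forall z, in_disk z -> in_disk (phi z).

(* x^p for x >= 0 (with 0^p = 0, p > 0) *)
Definition rpow (x p : R) : R :=
  if Rlt_dec 0 x then Rpower x p else 0.

Definition mean_p (p : R) (g : C -> C) (r : R) : R :=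
  / (2 * PI) * RInt (fun t => rpow (Cmod (g (r * cos t, r * sin t)%R)) p) 0 (2 * PI).

Definition Hp_sup (p : R) (g : C -> C) : Rbar :=
  Lub_Rbar (fun x => exists r, 0 < r < 1 /\ x = mean_p p g r).

Definition in_Hp (p : R) (g : C -> C) : Prop :=
  analytic_on_disk g /\ Rbar_lt (Hp_sup p g) p_infty.

(* ||g||_{H^p} = (sup_r M_p(r,g)^p)^(1/p), meaningful for g in H^p *)
Definition Hp_norm (p : R) (g : C -> C) : R :=
  rpow (real (Hp_sup p g)) (/ p).

Definition in_Sp (p : R) (f : C -> C) : Prop :=
  analytic_on_disk f /\ in_Hp p (cderiv f).

Definition Sp_norm (p : R) (f : C -> C) : R :=
  Cmod (f 0%C) + Hp_norm p (cderiv f).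

Definition D_op (phi : C -> C) (f : C -> C) : C -> C :=
  fun z => cderiv f (phi z).

Definition compact_D_Sp (p : R) (phi : C -> C) : Prop :=
  (forall f, in_Sp p f -> in_Sp p (D_op phi f)) /\
  forall (fs : nat -> C -> C) (M : R),
    (forall n, in_Sp p (fs n) /\ Sp_norm p (fs n) <= M) ->
    exists (sub : nat -> nat) (g : C -> C),
      (forall k, (sub k < sub (S k))%nat) /\ in_Sp p g /\
      is_lim_seq (fun k => Sp_norm p (fun z => (D_op phi (fs (sub k)) z - g z)%C)) 0.

Definition sup_norm (phi : C -> C) : Rbar :=
  Lub_Rbar (fun x => exists z, in_disk z /\ x = Cmod (phi z)).

(* Main.v *)
(** Point evaluations are bounded on S^p because p > 1: the growth estimate
    |g(w)| <= 5 ||g|| (1 - |w|)^(-1/p) of H^p (from the Poisson formula) is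
    integrable along radii.  If sup |phi| = 1, pick z_n with a_n = phi(z_n) tending
    to the circle, and the primitives f_n of normalized squared Cauchy kernels at a_n.
    They are bounded in S^p, but f_n'(phi(z_n)) is of order (1 - |a_n|)^(-1/p), so no
    subsequence of f_n' o phi converges in S^p.
    If |phi| <= rho < 1, a bounded sequence f_n has, by Montel, a subsequence for which
    f_n' and f_n'' converge uniformly on |w| <= rho, and the derivative f_n''(phi) phi'
    then converges in H^p since phi' is in H^p. *)
Require Import Defs.
From Stdlib Require Import Reals Lra Lia ClassicalEpsilon.
From Coquelicot Require Import Coquelicot.
Open Scope R_scope.

(** * Complex derivatives *)

(** In the necessity part the evaluation points z_n move with n, so convergence at each fixed point
    of the disk would contradict nothing. What works is that an S^p function is bounded on the whole
    disk by a quantity that does not depend on the point: the limit g and the differences f_n' o phi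
    - g stay bounded at the z_n, while f_n'(phi(z_n)) does not. In the sufficiency part the limit U
    of the f_n' is built only on a disk of radius r with rho < r < 1, which suffices because it is
    only composed with phi. Membership in S^p asks for (U o phi)' to be analytic, so a second
    derivative of U has to be produced together with the first. Everything rests on Cauchy's
    formula, obtained by contracting the circle linearly to the point z and differentiating under
    the integral sign. This uses continuity of f', which S^p membership supplies, since there f' is
    itself analytic. Kernel integrals then give the higher derivatives, with explicit constants that
    are uniform along a bounded sequence. *)

Lemma has_cderiv_iff (f : C -> C) (z l : C) :
  has_cderiv f z l <->
  forall eps, 0 < eps -> exists delta, 0 < delta /\
    forall w, Cmod (w - z) < delta ->
      Cmod (f w - f z - l * (w - z)) <= eps * Cmod (w - z).
Proof.
  split.
  - intros [_ H] eps He.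
    specialize (H z (fun P HP => HP) (mkposreal eps He)).
    destruct H as [d Hd]. exists d. split. apply cond_pos.
    intros w Hw. specialize (Hd w Hw). simpl in Hd.
    rewrite (Cmult_comm l). exact Hd.
  - intros H. split. apply is_linear_scal_l.
    intros x Hx.
    assert (x = z) as ->.
    { symmetry. apply (is_filter_lim_locally_unique (K:=C_AbsRing) (V:=AbsRing_NormedModule C_AbsRing)). exact Hx. }
    intros [eps He]. destruct (H eps He) as [d [Hd Hw]].
    exists (mkposreal d Hd). intros w Hball. simpl.
    specialize (Hw w Hball). rewrite (Cmult_comm l) in Hw. exact Hw.
Qed.

(** Two module structures live on the same set with the same norm. The product rule is stated for
    the field as a module over itself, [has_cderiv] for [C_NormedModule]; this is the bridge. *)
Lemma is_derive_C_iff (f : C -> C) (z l : C) :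
  has_cderiv f z l <-> @is_derive C_AbsRing (AbsRing_NormedModule C_AbsRing) f z l.
Proof.
  split; intros [_ H]; (split; [apply is_linear_scal_l | exact H]).
Qed.

Lemma cderiv_unique (f : C -> C) (z l : C) : has_cderiv f z l -> cderiv f z = l.
Proof.
  intros H. unfold cderiv.
  destruct excluded_middle_informative as [e|n].
  - destruct constructive_indefinite_description as [l' Hl']. simpl.
    rewrite <- (is_C_derive_unique _ _ _ H). symmetry. exact (is_C_derive_unique _ _ _ Hl').
  - exfalso. eauto.
Qed.

Lemma cderiv_correct (f : C -> C) (z : C) :
  (exists l, has_cderiv f z l) -> has_cderiv f z (cderiv f z).
Proof.
  intros [l Hl]. rewrite (cderiv_unique _ _ _ Hl). exact Hl.
Qed.

Definition ccont (f : C -> C) (z : C) : Prop :=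
  forall eps, 0 < eps -> exists delta, 0 < delta /\
    forall w, Cmod (w - z) < delta -> Cmod (f w - f z) < eps.

Lemma has_cderiv_ccont (f : C -> C) (z l : C) : has_cderiv f z l -> ccont f z.
Proof.
  intros H eps He. destruct (proj1 (has_cderiv_iff _ _ _) H 1 Rlt_0_1) as [d [Hd Hw]].
  pose proof (Cmod_ge_0 l) as Hl.
  assert (Hq : 0 < eps / (2 + Cmod l)) by (apply Rdiv_lt_0_compat; lra).
  exists (Rmin d (eps / (2 + Cmod l))). split. apply Rmin_pos; lra.
  intros w Hd'.
  assert (H1 : Cmod (w - z) < d) by (eapply Rlt_le_trans; [exact Hd'|apply Rmin_l]).
  assert (H2 : Cmod (w - z) < eps / (2 + Cmod l)) by (eapply Rlt_le_trans; [exact Hd'|apply Rmin_r]).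
  specialize (Hw w H1).
  replace (f w - f z)%C with ((f w - f z - l * (w - z)) + l * (w - z))%C by ring.
  eapply Rle_lt_trans. apply Cmod_triangle. rewrite Cmod_mult.
  apply Rle_lt_trans with ((2 + Cmod l) * Cmod (w - z)).
  - pose proof (Cmod_ge_0 (w - z)). nra.
  - apply Rlt_le_trans with ((2 + Cmod l) * (eps / (2 + Cmod l))).
    + apply Rmult_lt_compat_l; lra.
    + right. field. lra.
Qed.

Lemma has_cderiv_ext_near (f g : C -> C) (z l : C) (d : R) :
  0 < d -> (forall w, Cmod (w - z) < d -> f w = g w) -> has_cderiv f z l -> has_cderiv g z l.
Proof.
  intros Hd Hfg H. apply (is_derive_ext_loc (K := C_AbsRing) f g); [|exact H].
  exists (mkposreal d Hd). intros w Hw. apply Hfg, Hw.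
Qed.

Lemma has_cderiv_const (c z : C) : has_cderiv (fun _ => c) z 0.
Proof. exact (is_derive_const (K := C_AbsRing) (V := C_NormedModule) c z). Qed.

Lemma has_cderiv_id (z : C) : has_cderiv (fun w => w) z 1.
Proof. apply is_derive_C_iff. exact (is_derive_id (K := C_AbsRing) z). Qed.

Lemma has_cderiv_minus (f g : C -> C) (z a b : C) :
  has_cderiv f z a -> has_cderiv g z b -> has_cderiv (fun w => f w - g w)%C z (a - b).
Proof. exact (is_derive_minus (K := C_AbsRing) (V := C_NormedModule) f g z a b). Qed.

Lemma has_cderiv_mult (f g : C -> C) (z a b : C) :
  has_cderiv f z a -> has_cderiv g z b ->
  has_cderiv (fun w => f w * g w)%C z (a * g z + f z * b).
Proof.
  intros Hf Hg. apply is_derive_C_iff in Hf. apply is_derive_C_iff in Hg.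
  apply is_derive_C_iff.
  exact (is_derive_mult (K := C_AbsRing) f g z a b Hf Hg Cmult_comm).
Qed.

Lemma has_cderiv_comp (f g : C -> C) (z a b : C) :
  has_cderiv f (g z) a -> has_cderiv g z b -> has_cderiv (fun w => f (g w)) z (b * a).
Proof.
  intros Hf Hg. apply is_derive_C_iff in Hg.
  exact (is_derive_comp (K := C_AbsRing) (V := C_NormedModule) f g z a b Hf Hg).
Qed.

Lemma Cmod_minus_sym (a b : C) : Cmod (a - b) = Cmod (b - a).
Proof. rewrite <- Cmod_opp. f_equal. ring. Qed.

Lemma Cmod_triangle_inv (a b : C) : Cmod a - Cmod b <= Cmod (a - b).
Proof.
  assert (Cmod a <= Cmod (a - b) + Cmod b).
  { replace a with ((a - b) + b)%C at 1 by ring. apply Cmod_triangle. }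
  lra.
Qed.

Lemma Cmod_minus_triangle (a b : C) : Cmod (a - b) <= Cmod a + Cmod b.
Proof. unfold Cminus. rewrite <- (Cmod_opp b). apply Cmod_triangle. Qed.

Lemma Cmod_pos_neq (z : C) : 0 < Cmod z -> z <> 0.
Proof. intros H. apply Cmod_gt_0, H. Qed.

Lemma has_cderiv_inv (z : C) : z <> 0 -> has_cderiv Cinv z (- (/ z * / z)).
Proof.
  intros Hz. apply has_cderiv_iff. intros eps He.
  pose proof (proj1 (Cmod_gt_0 z) Hz) as Hm.
  assert (Hq : 0 < eps * (Cmod z * Cmod z * Cmod z) / 2).
  { apply Rdiv_lt_0_compat; [|lra]. repeat apply Rmult_lt_0_compat; lra. }
  (* The error is exactly (w - z)^2 / (w z^2). The first radius gives |w| > |z| / 2, and the second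
     then bounds the remaining factor by [eps]. *)
  exists (Rmin (Cmod z / 2) (eps * (Cmod z * Cmod z * Cmod z) / 2)).
  split. apply Rmin_pos; lra.
  intros w Hw.
  assert (H1 : Cmod (w - z) < Cmod z / 2) by (eapply Rlt_le_trans; [exact Hw|apply Rmin_l]).
  assert (H2 : Cmod (w - z) < eps * (Cmod z * Cmod z * Cmod z) / 2) by (eapply Rlt_le_trans; [exact Hw|apply Rmin_r]).
  assert (H3 : Cmod z / 2 < Cmod w).
  { pose proof (Cmod_triangle_inv z w). rewrite (Cmod_minus_sym z w) in H. lra. }
  assert (Hw0 : w <> 0) by (apply Cmod_pos_neq; lra).
  replace (/ w - / z - - (/ z * / z) * (w - z))%C with
    ((w - z) * (w - z) * / (w * (z * z)))%C by (field; split; assumption).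
  rewrite !Cmod_mult, Cmod_inv, !Cmod_mult.
  2:{ repeat apply Cmult_neq_0; assumption. }
  pose proof (Cmod_ge_0 (w - z)).
  rewrite (Rmult_comm _ (/ _)).
  apply (Rmult_le_reg_l (Cmod w * (Cmod z * Cmod z))).
  { repeat apply Rmult_lt_0_compat; lra. }
  rewrite <- Rmult_assoc, Rinv_r, Rmult_1_l.
  2:{ apply Rgt_not_eq. repeat apply Rmult_lt_0_compat; lra. }
  rewrite <- Rmult_assoc. apply Rmult_le_compat_r; [lra|].
  assert (Cmod z / 2 * (Cmod z * Cmod z) <= Cmod w * (Cmod z * Cmod z)).
  { apply Rmult_le_compat_r. nra. lra. }
  nra.
Qed.

(** * Circle means *)

(** Continuity on the whole line makes every integrability side condition for [RInt] immediate. *)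
Definition rcont (u : R -> R) : Prop := forall t, continuous u t.

Definition ccurve (u : R -> C) : Prop :=
  rcont (fun t => Re (u t)) /\ rcont (fun t => Im (u t)).

Definition rmean (u : R -> R) : R := / (2 * PI) * RInt u 0 (2 * PI).

Definition cmean (u : R -> C) : C :=
  (rmean (fun t => Re (u t)), rmean (fun t => Im (u t))).

Lemma two_PI_pos : 0 < 2 * PI.
Proof. pose proof PI_RGT_0. lra. Qed.

Lemma rcont_ex_RInt (u : R -> R) (a b : R) : rcont u -> ex_RInt u a b.
Proof. intros H. apply (ex_RInt_continuous (V := R_CompleteNormedModule)). intros; apply H. Qed.

Lemma rcont_const (c : R) : rcont (fun _ => c).
Proof. intros t. apply continuous_const. Qed.

Lemma rcont_plus (u v : R -> R) : rcont u -> rcont v -> rcont (fun t => u t + v t).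
Proof. intros Hu Hv t. apply (continuous_plus u v); auto. Qed.

Lemma rcont_opp (u : R -> R) : rcont u -> rcont (fun t => - u t).
Proof. intros Hu t. apply (continuous_opp u); auto. Qed.

Lemma rcont_minus (u v : R -> R) : rcont u -> rcont v -> rcont (fun t => u t - v t).
Proof. intros Hu Hv t. apply (continuous_minus u v); auto. Qed.

Lemma rcont_mult (u v : R -> R) : rcont u -> rcont v -> rcont (fun t => u t * v t).
Proof. intros Hu Hv t. apply (continuous_mult (K := R_AbsRing) u v); auto. Qed.

Lemma rcont_inv (u : R -> R) : (forall t, u t <> 0) -> rcont u -> rcont (fun t => / u t).
Proof.
  intros H0 Hu t. apply continuity_pt_filterlim.
  apply (continuity_pt_inv u); [|apply H0]. apply continuity_pt_filterlim, Hu.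
Qed.

Lemma rcont_ext (u v : R -> R) : (forall t, u t = v t) -> rcont u -> rcont v.
Proof. intros H Hu t. apply (continuous_ext u); auto. Qed.

Lemma rmean_ext (u v : R -> R) : (forall t, u t = v t) -> rmean u = rmean v.
Proof. intros H. unfold rmean. f_equal. apply RInt_ext. intros; apply H. Qed.

Lemma rmean_plus (u v : R -> R) :
  rcont u -> rcont v -> rmean (fun t => u t + v t) = rmean u + rmean v.
Proof.
  intros Hu Hv. unfold rmean. rewrite <- Rmult_plus_distr_l. f_equal.
  apply (RInt_plus (V := R_CompleteNormedModule)); apply rcont_ex_RInt; assumption.
Qed.

Lemma rmean_scal (c : R) (u : R -> R) : rcont u -> rmean (fun t => c * u t) = c * rmean u.
Proof.
  intros Hu. unfold rmean.
  assert (RInt (fun t => c * u t) 0 (2 * PI) = c * RInt u 0 (2 * PI)) as ->.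
  { apply (RInt_scal (V := R_CompleteNormedModule)). apply rcont_ex_RInt, Hu. }
  ring.
Qed.

Lemma rmean_minus (u v : R -> R) :
  rcont u -> rcont v -> rmean (fun t => u t - v t) = rmean u - rmean v.
Proof.
  intros Hu Hv. unfold rmean. rewrite <- Rmult_minus_distr_l. f_equal.
  apply (RInt_minus (V := R_CompleteNormedModule)); apply rcont_ex_RInt; assumption.
Qed.

Lemma rmean_const (c : R) : rmean (fun _ => c) = c.
Proof.
  unfold rmean. rewrite RInt_const. unfold scal; simpl; unfold mult; simpl.
  field. apply PI_neq0.
Qed.

Lemma rmean_le (u v : R -> R) :
  rcont u -> rcont v -> (forall t, u t <= v t) -> rmean u <= rmean v.
Proof.
  intros Hu Hv H. unfold rmean. pose proof two_PI_pos.
  apply Rmult_le_compat_l. left. apply Rinv_0_lt_compat; lra.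
  apply RInt_le; [lra| | |]; try (apply rcont_ex_RInt; assumption).
  intros; apply H.
Qed.

Lemma ccurve_const (c : C) : ccurve (fun _ => c).
Proof. split; apply rcont_const. Qed.

Lemma ccurve_plus (u v : R -> C) : ccurve u -> ccurve v -> ccurve (fun t => u t + v t)%C.
Proof. intros [Hu1 Hu2] [Hv1 Hv2]. split; apply rcont_plus; assumption. Qed.

Lemma ccurve_minus (u v : R -> C) : ccurve u -> ccurve v -> ccurve (fun t => u t - v t)%C.
Proof.
  intros [Hu1 Hu2] [Hv1 Hv2]. split; apply rcont_plus; try assumption; apply rcont_opp; assumption.
Qed.

Lemma ccurve_mult (u v : R -> C) : ccurve u -> ccurve v -> ccurve (fun t => u t * v t)%C.
Proof.
  intros [Hu1 Hu2] [Hv1 Hv2]. split.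
  - apply rcont_minus; apply rcont_mult; assumption.
  - apply rcont_plus; apply rcont_mult; assumption.
Qed.

Lemma Cmod_sqr_pos (z : C) : z <> 0 -> Re z ^ 2 + Im z ^ 2 <> 0.
Proof. intros H. rewrite <- Cmod2_alt. apply pow_nonzero, Rgt_not_eq, Cmod_gt_0, H. Qed.

Lemma ccurve_inv (u : R -> C) : (forall t, u t <> 0) -> ccurve u -> ccurve (fun t => / u t)%C.
Proof.
  intros H0 [H1 H2].
  assert (Hd : rcont (fun t => / (Re (u t) ^ 2 + Im (u t) ^ 2))).
  { apply rcont_inv. intros t. apply Cmod_sqr_pos, H0.
    apply rcont_plus; simpl; repeat apply rcont_mult; try assumption; apply rcont_const. }
  split.
  - apply rcont_mult; assumption.
  - apply rcont_mult; [apply rcont_opp, H2|assumption].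
Qed.

Lemma ccurve_pow (u : R -> C) (n : nat) : ccurve u -> ccurve (fun t => (u t) ^ n)%C.
Proof.
  intros H. induction n as [|n IH]; simpl.
  - apply ccurve_const.
  - apply ccurve_mult; assumption.
Qed.

Lemma Cmod_re_im (z : C) : Cmod z = sqrt (Re z * Re z + Im z * Im z).
Proof. unfold Cmod. f_equal. unfold Re, Im. ring. Qed.

Lemma Im_le_Cmod (z : C) : Rabs (Im z) <= Cmod z.
Proof. eapply Rle_trans; [|apply Rmax_Cmod]. apply Rmax_r. Qed.

Lemma Cmod_le_Re_Im (z : C) : Cmod z <= Rabs (Re z) + Rabs (Im z).
Proof.
  rewrite Cmod_re_im. pose proof (Rabs_pos (Re z)). pose proof (Rabs_pos (Im z)).
  rewrite <- (sqrt_Rsqr (Rabs (Re z) + Rabs (Im z))) by lra.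
  apply sqrt_le_1_alt. unfold Rsqr.
  pose proof (Rsqr_abs (Re z)). pose proof (Rsqr_abs (Im z)). unfold Rsqr in *. nra.
Qed.

Lemma rcont_Cmod (u : R -> C) : ccurve u -> rcont (fun t => Cmod (u t)).
Proof.
  intros [H1 H2].
  apply rcont_ext with (fun t => sqrt (Re (u t) * Re (u t) + Im (u t) * Im (u t))).
  { intros t. symmetry. apply Cmod_re_im. }
  assert (H : rcont (fun t => Re (u t) * Re (u t) + Im (u t) * Im (u t))).
  { apply rcont_plus; apply rcont_mult; assumption. }
  intros t. apply (continuous_comp (fun t => Re (u t) * Re (u t) + Im (u t) * Im (u t)) sqrt).
  apply H. apply continuity_pt_filterlim, continuity_pt_sqrt. nra.
Qed.

Lemma ccurve_eps (u : R -> C) :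
  ccurve u <-> forall t eps, 0 < eps -> exists d, 0 < d /\
    forall s, Rabs (s - t) < d -> Cmod (u s - u t) < eps.
Proof.
  split.
  - intros [H1 H2] t eps He.
    assert (He2 : 0 < eps / 2) by lra.
    destruct (proj1 (filterlim_locally _ _) (H1 t) (mkposreal _ He2)) as [d1 Hd1].
    destruct (proj1 (filterlim_locally _ _) (H2 t) (mkposreal _ He2)) as [d2 Hd2].
    exists (Rmin d1 d2). split. apply Rmin_pos; apply cond_pos.
    intros s Hs.
    assert (A1 := Hd1 s (Rlt_le_trans _ _ _ Hs (Rmin_l _ _))).
    assert (A2 := Hd2 s (Rlt_le_trans _ _ _ Hs (Rmin_r _ _))).
    simpl in A1, A2. unfold ball in A1, A2. simpl in A1, A2.
    unfold AbsRing_ball, abs, minus, plus, opp in A1, A2. simpl in A1, A2.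
    eapply Rle_lt_trans. apply Cmod_le_Re_Im.
    replace (Re (u s - u t)) with (Re (u s) + - Re (u t)) by reflexivity.
    replace (Im (u s - u t)) with (Im (u s) + - Im (u t)) by reflexivity. lra.
  - intros H. split; intros t; apply filterlim_locally; intros eps;
      destruct (H t eps (cond_pos eps)) as [d [Hd Hs]];
      exists (mkposreal d Hd); intros s Hb; specialize (Hs s Hb);
      (eapply Rle_lt_trans; [|exact Hs]).
    + exact (re_le_Cmod (u s - u t)).
    + exact (Im_le_Cmod (u s - u t)).
Qed.

Lemma ccont_ccurve (f : C -> C) (u : R -> C) :
  (forall t, ccont f (u t)) -> ccurve u -> ccurve (fun t => f (u t)).
Proof.
  intros Hf Hu. apply ccurve_eps. intros t eps He.
  destruct (Hf t eps He) as [d [Hd H1]].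
  destruct (proj1 (ccurve_eps u) Hu t d Hd) as [d' [Hd' H2]].
  exists d'. split; [assumption|]. intros s Hs. apply H1, H2, Hs.
Qed.

Lemma cmean_ext (u v : R -> C) : (forall t, u t = v t) -> cmean u = cmean v.
Proof. intros H. unfold cmean. f_equal; apply rmean_ext; intros t; rewrite H; reflexivity. Qed.

Lemma cmean_plus (u v : R -> C) :
  ccurve u -> ccurve v -> cmean (fun t => u t + v t)%C = (cmean u + cmean v)%C.
Proof. intros [Hu1 Hu2] [Hv1 Hv2]. unfold cmean, Cplus; simpl. f_equal; apply rmean_plus; assumption. Qed.

Lemma cmean_scal (c : C) (u : R -> C) :
  ccurve u -> cmean (fun t => c * u t)%C = (c * cmean u)%C.
Proof.
  intros [H1 H2]. unfold cmean, Cmult; simpl. f_equal.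
  - unfold Re at 1. simpl. rewrite <- !rmean_scal by assumption.
    rewrite <- rmean_minus; [reflexivity| |]; (apply rcont_mult; [apply rcont_const|assumption]).
  - unfold Im at 1. simpl. rewrite <- !rmean_scal by assumption.
    rewrite <- rmean_plus; [reflexivity| |]; (apply rcont_mult; [apply rcont_const|assumption]).
Qed.

Lemma cmean_minus (u v : R -> C) :
  ccurve u -> ccurve v -> cmean (fun t => u t - v t)%C = (cmean u - cmean v)%C.
Proof.
  intros [Hu1 Hu2] [Hv1 Hv2]. unfold cmean, Cminus, Cplus, Copp; simpl.
  f_equal; apply rmean_minus; assumption.
Qed.

Lemma cmean_const (c : C) : cmean (fun _ => c) = c.
Proof. unfold cmean. rewrite !rmean_const. symmetry. apply surjective_pairing. Qed.

Lemma cmean_conj (u : R -> C) : ccurve u -> cmean (fun t => Cconj (u t)) = Cconj (cmean u).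
Proof.
  intros [H1 H2]. unfold cmean, Cconj; simpl. f_equal.
  transitivity (rmean (fun t => -1 * Im (u t))).
  - apply rmean_ext. intros t. unfold Im; simpl. ring.
  - rewrite rmean_scal by assumption. ring.
Qed.

(* Rotating [cmean u] onto the positive axis reduces this to real parts. *)
Lemma Cmod_cmean_le (u : R -> C) (g : R -> R) :
  ccurve u -> rcont g -> (forall t, Cmod (u t) <= g t) -> Cmod (cmean u) <= rmean g.
Proof.
  intros Hu Hg H.
  destruct (Ceq_dec (cmean u) 0) as [E|E].
  - rewrite E, Cmod_0. rewrite <- (rmean_const 0). apply rmean_le; [apply rcont_const|assumption|].
    intros t. eapply Rle_trans; [apply Cmod_ge_0|apply H].
  - pose proof (proj1 (Cmod_gt_0 _) E) as Hp.
    set (c := (Cconj (cmean u) * / RtoC (Cmod (cmean u)))%C).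
    assert (Hc : Cmod c = 1).
    { unfold c. rewrite Cmod_mult, Cmod_conj, Cmod_inv, Cmod_R, Rabs_pos_eq.
      field. lra. lra. intros A. apply RtoC_inj in A. lra. }
    assert (Hcu : (c * cmean u)%C = RtoC (Cmod (cmean u))).
    { unfold c. replace (Cconj (cmean u) * / RtoC (Cmod (cmean u)) * cmean u)%C with
        (cmean u * Cconj (cmean u) * / RtoC (Cmod (cmean u)))%C by ring.
      rewrite <- Cmod2_conj, RtoC_pow. field. intros A. apply RtoC_inj in A. lra. }
    rewrite <- (re_RtoC (Cmod (cmean u))), <- Hcu, <- cmean_scal by assumption.
    destruct (ccurve_mult _ _ (ccurve_const c) Hu) as [H1 H2].
    change (rmean (fun t => Re (c * u t)) <= rmean g).
    apply rmean_le; [assumption|assumption|].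
    intros t. eapply Rle_trans; [apply Rle_abs|]. eapply Rle_trans; [apply re_le_Cmod|].
    rewrite Cmod_mult, Hc, Rmult_1_l. apply H.
Qed.

Lemma Cmod_cmean_bound (u : R -> C) (M : R) :
  ccurve u -> (forall t, Cmod (u t) <= M) -> Cmod (cmean u) <= M.
Proof.
  intros Hu H. rewrite <- (rmean_const M). apply Cmod_cmean_le; [assumption|apply rcont_const|assumption].
Qed.

(** Written as a pair so that [mean_p] unfolds to an [rmean] along [zeta] by conversion. *)
Definition zeta (r t : R) : C := (r * cos t, r * sin t).

Lemma Cmod_zeta (r t : R) : 0 <= r -> Cmod (zeta r t) = r.
Proof.
  intros Hr. unfold Cmod, zeta. simpl.
  replace (r * cos t * (r * cos t * 1) + r * sin t * (r * sin t * 1)) with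
    (Rsqr r * (Rsqr (sin t) + Rsqr (cos t))) by (unfold Rsqr; ring).
  rewrite sin2_cos2, Rmult_1_r. apply sqrt_Rsqr, Hr.
Qed.

Lemma ccurve_zeta (r : R) : ccurve (zeta r).
Proof.
  split; (apply rcont_mult; [apply rcont_const|]); intros t.
  - apply continuous_cos.
  - apply continuous_sin.
Qed.

(** * Cauchy's formula *)

Definition vderiv (u : R -> C) (s : R) (d : C) : Prop :=
  is_derive (fun t => Re (u t)) s (Re d) /\ is_derive (fun t => Im (u t)) s (Im d).

(** Complex differentiability is real differentiability in two variables with a matrix of
    Cauchy-Riemann form: the partial derivatives of Re f are [Re l], [- Im l], those of Im f are
    [Im l], [Re l]. The real chain rule then applies to each component. *)
Lemma vderiv_comp (f : C -> C) (u : R -> C) (s : R) (l d : C) :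
  has_cderiv f (u s) l -> vderiv u s d -> vderiv (fun t => f (u t)) s (l * d)%C.
Proof.
  intros Hf [H1 H2].
  assert (Hd : forall eps : posreal, locally_2d (fun x y =>
     Cmod (f (x, y) - f (u s) - l * ((x, y) - u s)) <=
     eps * Rmax (Rabs (x - Re (u s))) (Rabs (y - Im (u s)))) (Re (u s)) (Im (u s))).
  { intros eps.
    (* The factor [sqrt 2] compares [Cmod] with the maximum norm used for real differentiability in
       two variables. *)
    assert (He : 0 < eps / sqrt 2).
    { apply Rdiv_lt_0_compat. apply cond_pos. apply Rlt_sqrt2_0. }
    destruct (proj1 (has_cderiv_iff _ _ _) Hf _ He) as [d0 [Hd0 Hw]].
    assert (Hd2 : 0 < d0 / 2) by lra.
    exists (mkposreal _ Hd2). simpl. intros x y Hx Hy.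
    assert (Hc : Cmod ((x, y) - u s) < d0).
    { eapply Rle_lt_trans. apply Cmod_le_Re_Im.
      change (Rabs (x - Re (u s)) + Rabs (y - Im (u s)) < d0). lra. }
    eapply Rle_trans. apply (Hw (x, y) Hc).
    apply Rle_trans with (eps / sqrt 2 * (sqrt 2 * Rmax (Rabs (x - Re (u s))) (Rabs (y - Im (u s))))).
    - apply Rmult_le_compat_l. lra. exact (Cmod_2Rmax ((x, y) - u s)).
    - right. field. apply Rgt_not_eq, Rlt_sqrt2_0. }
  assert (Hu : forall t, (Re (u t), Im (u t)) = u t) by (intros; symmetry; apply surjective_pairing).
  split; apply is_derive_Reals; apply is_derive_Reals in H1; apply is_derive_Reals in H2.
  - assert (Hp := derivable_pt_lim_comp_2d (fun x y => Re (f (x, y))) (fun t => Re (u t)) (fun t => Im (u t))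
        s (Re l) (- Im l) (Re d) (Im d)).
    replace (Re (l * d)) with (Re l * Re d + - Im l * Im d) by (rewrite re_mult; ring).
    apply is_derive_Reals.
    apply is_derive_ext with (fun t => Re (f (Re (u t), Im (u t)))).
    { intros t. rewrite Hu. reflexivity. }
    apply is_derive_Reals. apply Hp; try assumption.
    intros eps. destruct (Hd eps) as [d0 Hw]. exists d0. intros x y Hx Hy.
    eapply Rle_trans; [|apply (Hw x y Hx Hy)]. rewrite Hu.
    eapply Rle_trans; [|apply re_le_Cmod]. right. f_equal.
    unfold Cminus. rewrite !re_plus, !re_opp, re_mult. unfold Re, Im; simpl. ring.
  - assert (Hp := derivable_pt_lim_comp_2d (fun x y => Im (f (x, y))) (fun t => Re (u t)) (fun t => Im (u t))
        s (Im l) (Re l) (Re d) (Im d)).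
    replace (Im (l * d)) with (Im l * Re d + Re l * Im d) by (rewrite im_mult; ring).
    apply is_derive_Reals.
    apply is_derive_ext with (fun t => Im (f (Re (u t), Im (u t)))).
    { intros t. rewrite Hu. reflexivity. }
    apply is_derive_Reals. apply Hp; try assumption.
    intros eps. destruct (Hd eps) as [d0 Hw]. exists d0. intros x y Hx Hy.
    eapply Rle_trans; [|apply (Hw x y Hx Hy)]. rewrite Hu.
    eapply Rle_trans; [|apply Im_le_Cmod]. right. f_equal.
    unfold Cminus. rewrite !im_plus, !im_opp, im_mult. unfold Re, Im; simpl. ring.
Qed.

Lemma has_cderiv_scal (c z : C) : has_cderiv (fun w => c * w)%C z c.
Proof.
  pose proof (has_cderiv_mult _ _ z _ _ (has_cderiv_const c z) (has_cderiv_id z)) as H.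
  simpl in H. replace (0 * z + c * 1)%C with c in H by ring. exact H.
Qed.

Lemma vderiv_scal (c : C) (u : R -> C) (s : R) (d : C) :
  vderiv u s d -> vderiv (fun t => c * u t)%C s (c * d)%C.
Proof. intros H. apply (vderiv_comp (fun w => c * w)%C). apply has_cderiv_scal. exact H. Qed.

Definition ccont2 (F : R -> R -> C) (x y : R) : Prop :=
  continuity_2d_pt (fun u v => Re (F u v)) x y /\ continuity_2d_pt (fun u v => Im (F u v)) x y.

Lemma ccont2_mult (F G : R -> R -> C) (x y : R) :
  ccont2 F x y -> ccont2 G x y -> ccont2 (fun u v => F u v * G u v)%C x y.
Proof.
  intros [F1 F2] [G1 G2]. split.
  - apply continuity_2d_pt_minus; apply continuity_2d_pt_mult; assumption.
  - apply continuity_2d_pt_plus; apply continuity_2d_pt_mult; assumption.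
Qed.

Lemma ccont2_plus (F G : R -> R -> C) (x y : R) :
  ccont2 F x y -> ccont2 G x y -> ccont2 (fun u v => F u v + G u v)%C x y.
Proof. intros [F1 F2] [G1 G2]. split; apply continuity_2d_pt_plus; assumption. Qed.

Lemma ccont2_const (c : C) (x y : R) : ccont2 (fun _ _ => c) x y.
Proof. split; apply continuity_2d_pt_const. Qed.

Lemma ccont2_fst (x y : R) : ccont2 (fun u _ => RtoC u) x y.
Proof. split. apply continuity_2d_pt_id1. exact (continuity_2d_pt_const x y 0). Qed.

Lemma ccont2_snd (u : R -> C) (x y : R) : ccurve u -> ccont2 (fun _ v => u v) x y.
Proof.
  intros [H1 H2].
  split; apply (continuity_1d_2d_pt_comp _ (fun _ v => v));
    try apply continuity_2d_pt_id2; apply continuity_pt_filterlim; [apply H1|apply H2].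
Qed.

Lemma ccont2_comp (f : C -> C) (F : R -> R -> C) (x y : R) :
  ccont f (F x y) -> ccont2 F x y -> ccont2 (fun u v => f (F u v)) x y.
Proof.
  intros Hf [F1 F2].
  assert (H : forall eps : posreal, locally_2d (fun u v => Cmod (f (F u v) - f (F x y)) < eps) x y).
  { intros eps. destruct (Hf eps (cond_pos eps)) as [d [Hd Hw]].
    assert (Hd2 : 0 < d / 2) by lra.
    destruct (F1 (mkposreal _ Hd2)) as [d1 H1]. destruct (F2 (mkposreal _ Hd2)) as [d2 H2].
    exists (mkposreal _ (Rmin_pos _ _ (cond_pos d1) (cond_pos d2))). simpl. intros u v Hu Hv.
    apply Hw. eapply Rle_lt_trans. apply Cmod_le_Re_Im.
    assert (A1 := H1 u v (Rlt_le_trans _ _ _ Hu (Rmin_l _ _)) (Rlt_le_trans _ _ _ Hv (Rmin_l _ _))).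
    assert (A2 := H2 u v (Rlt_le_trans _ _ _ Hu (Rmin_r _ _)) (Rlt_le_trans _ _ _ Hv (Rmin_r _ _))).
    simpl in A1, A2.
    change (Rabs (Re (F u v) - Re (F x y)) + Rabs (Im (F u v) - Im (F x y)) < d). lra. }
  split; intros eps; destruct (H eps) as [d Hw]; exists d; intros u v Hu Hv;
    (eapply Rle_lt_trans; [|exact (Hw u v Hu Hv)]).
  - exact (re_le_Cmod (f (F u v) - f (F x y))).
  - exact (Im_le_Cmod (f (F u v) - f (F x y))).
Qed.

(** Leibniz's rule followed by the mean value theorem. The margin [d] gives the endpoints 0 and 1
    the open neighbourhoods that differentiation under the integral sign requires; the mean of the
    derivative has to vanish only strictly between them. *)
Lemma rmean_const_param (H D : R -> R -> R) (d : R) :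
  0 < d ->
  (forall l t, - d < l < 1 + d -> is_derive (fun x => H x t) l (D l t)) ->
  (forall l t, - d < l < 1 + d -> continuity_2d_pt D l t) ->
  (forall l, - d < l < 1 + d -> rcont (H l)) ->
  (forall l, 0 < l < 1 -> rmean (D l) = 0) ->
  rmean (H 1) = rmean (H 0).
Proof.
  intros Hd HD Hc Hr H0.
  assert (Hloc : forall l, - d < l < 1 + d -> locally l (fun x => - d < x < 1 + d)).
  { intros l Hl. apply (open_and (fun x => - d < x) (fun x => x < 1 + d)).
    apply open_gt. apply open_lt. exact Hl. }
  assert (HI : forall l, - d < l < 1 + d ->
     is_derive (fun x => RInt (H x) 0 (2 * PI)) l (RInt (D l) 0 (2 * PI))).
  { intros l Hl.
    assert (E : RInt (fun t => Derive (fun x => H x t) l) 0 (2 * PI) = RInt (D l) 0 (2 * PI)).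
    { apply RInt_ext. intros t _. apply is_derive_unique, HD, Hl. }
    rewrite <- E. apply (is_derive_RInt_param H).
    - eapply filter_imp; [|apply (Hloc l Hl)]. intros x Hx t _.
      exists (D x t). apply HD, Hx.
    - intros t _. apply (continuity_2d_pt_ext_loc D).
      + destruct (Hloc l Hl) as [e He]. exists e. intros u v Hu _. symmetry.
        apply is_derive_unique, HD. apply He, Hu.
      + apply Hc, Hl.
    - eapply filter_imp; [|apply (Hloc l Hl)]. intros x Hx.
      apply rcont_ex_RInt, Hr, Hx. }
  destruct (MVT_gen (fun x => RInt (H x) 0 (2 * PI)) 0 1 (fun _ => 0)) as [c [_ E]].
  - rewrite Rmin_left, Rmax_right by lra. intros x Hx.
    assert (Hx' : - d < x < 1 + d) by lra. pose proof (HI x Hx') as A.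
    assert (RInt (D x) 0 (2 * PI) = 0) as B.
    { specialize (H0 x Hx). unfold rmean in H0. apply Rmult_integral in H0. destruct H0 as [H0|H0]; [|exact H0].
      exfalso. revert H0. apply Rinv_neq_0_compat. pose proof two_PI_pos. lra. }
    rewrite B in A. exact A.
  - rewrite Rmin_left, Rmax_right by lra. intros x Hx.
    apply continuity_pt_filterlim. apply (ex_derive_continuous (K := R_AbsRing) (V := R_NormedModule)
      (fun x => RInt (H x) 0 (2 * PI))).
    eexists. apply HI. lra.
  - unfold rmean. f_equal. lra.
Qed.

Lemma rmean_derivative_periodic (F D : R -> R) :
  (forall t, is_derive F t (D t)) -> rcont D -> F (2 * PI) = F 0 -> rmean D = 0.
Proof.
  intros HD Hc HF. unfold rmean.
  rewrite (is_RInt_unique D 0 (2 * PI) (minus (F (2 * PI)) (F 0))).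
  - rewrite HF. rewrite minus_eq_zero. apply Rmult_0_r.
  - apply (is_RInt_derive (V := R_CompleteNormedModule) F D); intros; [apply HD|apply Hc].
Qed.

Lemma zeta_period (r : R) : zeta r (2 * PI) = zeta r 0.
Proof. unfold zeta. rewrite cos_2PI, sin_2PI, cos_0, sin_0. reflexivity. Qed.

Definition holo_on (f f' : C -> C) (rho : R) : Prop :=
  forall w, Cmod w < rho -> has_cderiv f w (f' w) /\ ccont f' w.

(** The linear homotopy from the constant path at [z] ([l = 0]) to the circle of radius [r]
    ([l = 1]). *)
Definition segm (z : C) (r l t : R) : C := (z + RtoC l * (zeta r t - z))%C.

Lemma vderiv_segm_l (z : C) (r l t : R) : vderiv (fun x => segm z r x t) l (zeta r t - z)%C.
Proof.
  unfold vderiv, segm, zeta, Re, Im; simpl. split; auto_derive; trivial; ring.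
Qed.

Lemma vderiv_segm_t (z : C) (r l t : R) :
  vderiv (segm z r l) t (RtoC l * (Ci * zeta r t))%C.
Proof.
  unfold vderiv, segm, zeta, Re, Im; simpl. split; auto_derive; trivial; ring.
Qed.

Lemma ccont2_segm (z : C) (r l t : R) : ccont2 (segm z r) l t.
Proof.
  apply ccont2_plus. apply ccont2_const. apply ccont2_mult. apply ccont2_fst.
  apply (ccont2_snd (fun t => zeta r t - z)%C). apply ccurve_minus. apply ccurve_zeta. apply ccurve_const.
Qed.

Lemma Cmod_segm (z : C) (r l t : R) :
  0 <= r -> Cmod z <= r -> Cmod (segm z r l t) <= r * (Rabs (1 - l) + Rabs l).
Proof.
  intros Hr Hz. unfold segm.
  replace (z + RtoC l * (zeta r t - z))%C with (RtoC (1 - l) * z + RtoC l * zeta r t)%C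
    by (rewrite RtoC_minus; ring).
  eapply Rle_trans. apply Cmod_triangle.
  rewrite !Cmod_mult, !Cmod_R, Cmod_zeta by assumption.
  pose proof (Rabs_pos (1 - l)). nra.
Qed.

Lemma zeta_minus_neq (z : C) (r t : R) : Cmod z < r -> (zeta r t - z)%C <> 0.
Proof.
  intros H. pose proof (Cmod_ge_0 z). apply Cmod_pos_neq.
  pose proof (Cmod_triangle_inv (zeta r t) z). rewrite Cmod_zeta in H1; lra.
Qed.

Lemma ccurve_kernel (z : C) (r : R) : Cmod z < r -> ccurve (fun t => / (zeta r t - z))%C.
Proof.
  intros H. apply ccurve_inv. intros t. apply zeta_minus_neq, H.
  apply ccurve_minus. apply ccurve_zeta. apply ccurve_const.
Qed.

(** Replace f(zeta) by f along [segm]. The factor zeta - z produced by d/dl cancels the pole of the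
    kernel and leaves f'(segm) zeta, which is the t-derivative of the periodic function f(segm) / (l
    i). Its mean is 0, so the mean at [l = 1] equals the mean at [l = 0], where f is the constant
    f(z). *)
Lemma cauchy_homotopy (f f' : C -> C) (rho r : R) (z : C) :
  holo_on f f' rho -> r < rho -> Cmod z < r ->
  cmean (fun t => f (zeta r t) * (zeta r t * / (zeta r t - z)))%C =
  (f z * cmean (fun t => zeta r t * / (zeta r t - z)))%C.
Proof.
  intros Hf Hr Hz.
  assert (Hr0 : 0 < r) by (eapply Rle_lt_trans; [apply Cmod_ge_0|exact Hz]).
  (* Chosen so that r (1 + 2 d) = rho: the homotopy stays in the domain of [f] for [l] slightly
     outside [0, 1]. *)
  set (d := (rho - r) / (2 * r)).
  assert (Hd : 0 < d) by (apply Rdiv_lt_0_compat; lra).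
  assert (Hin : forall l t, - d < l < 1 + d -> Cmod (segm z r l t) < rho).
  { intros l t Hl. eapply Rle_lt_trans. apply Cmod_segm; lra.
    assert (Rabs (1 - l) + Rabs l < 1 + 2 * d).
    { unfold Rabs. destruct (Rcase_abs (1 - l)), (Rcase_abs l); lra. }
    apply Rlt_le_trans with (r * (1 + 2 * d)). apply Rmult_lt_compat_l; assumption.
    right. unfold d. field. lra. }
  set (K := fun t => (zeta r t * / (zeta r t - z))%C).
  assert (HK : ccurve K).
  { apply ccurve_mult. apply ccurve_zeta. apply ccurve_kernel, Hz. }
  set (H := fun l t => (K t * f (segm z r l t))%C).
  set (D := fun l t => (f' (segm z r l t) * zeta r t)%C).
  assert (Hsc : forall l, ccurve (segm z r l)).
  { intros l. apply ccurve_plus. apply ccurve_const. apply ccurve_mult. apply ccurve_const.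
    apply ccurve_minus. apply ccurve_zeta. apply ccurve_const. }
  assert (HD : forall l t, - d < l < 1 + d -> vderiv (fun x => H x t) l (D l t)).
  { intros l t Hl. unfold H, D.
    replace (f' (segm z r l t) * zeta r t)%C with
      (K t * (f' (segm z r l t) * (zeta r t - z)))%C.
    - apply vderiv_scal. apply (vderiv_comp f (fun x => segm z r x t)).
      apply Hf, Hin, Hl. apply vderiv_segm_l.
    - unfold K. field. apply zeta_minus_neq, Hz. }
  assert (HDc : forall l t, - d < l < 1 + d -> ccont2 D l t).
  { intros l t Hl. apply ccont2_mult.
    - apply ccont2_comp. apply Hf, Hin, Hl. apply ccont2_segm.
    - apply (ccont2_snd (zeta r)). apply ccurve_zeta. }
  assert (HHc : forall l, - d < l < 1 + d -> ccurve (H l)).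
  { intros l Hl. apply ccurve_mult. exact HK. apply ccont_ccurve; [|apply Hsc].
    intros t. eapply has_cderiv_ccont. apply Hf, Hin, Hl. }
  assert (HDr : forall l, - d < l < 1 + d -> ccurve (D l)).
  { intros l Hl. apply ccurve_mult; [|apply ccurve_zeta]. apply ccont_ccurve; [|apply Hsc].
    intros t. apply Hf, Hin, Hl. }
  (* The primitive in [t] divides by [l], so the value [l = 0] is left out here. *)
  assert (HP : forall l, 0 < l < 1 -> forall t,
     vderiv (fun t => / (RtoC l * Ci) * f (segm z r l t))%C t (D l t)).
  { intros l Hl t.
    replace (D l t) with (/ (RtoC l * Ci) * (f' (segm z r l t) * (RtoC l * (Ci * zeta r t))))%C.
    - apply vderiv_scal. apply (vderiv_comp f (segm z r l)). apply Hf, Hin; lra. apply vderiv_segm_t.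
    - unfold D. field. split. apply Ci_nz. intros E. apply RtoC_inj in E. lra. }
  assert (Hper : forall l, segm z r l (2 * PI) = segm z r l 0).
  { intros l. unfold segm. rewrite zeta_period. reflexivity. }
  assert (E : cmean (H 1) = cmean (H 0)).
  { unfold cmean. f_equal.
    - apply (rmean_const_param (fun l t => Re (H l t)) (fun l t => Re (D l t)) d Hd).
      + intros l t Hl. apply HD, Hl.
      + intros l t Hl. apply HDc, Hl.
      + intros l Hl. exact (proj1 (HHc l Hl)).
      + intros l Hl. eapply rmean_derivative_periodic. intros t. apply (HP l Hl t).
        exact (proj1 (HDr l ltac:(lra))). simpl. rewrite Hper. reflexivity.
    - apply (rmean_const_param (fun l t => Im (H l t)) (fun l t => Im (D l t)) d Hd).
      + intros l t Hl. apply HD, Hl.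
      + intros l t Hl. apply HDc, Hl.
      + intros l Hl. exact (proj2 (HHc l Hl)).
      + intros l Hl. eapply rmean_derivative_periodic. intros t. apply (HP l Hl t).
        exact (proj2 (HDr l ltac:(lra))). simpl. rewrite Hper. reflexivity. }
  rewrite <- cmean_scal by exact HK.
  transitivity (cmean (H 1)); [|rewrite E]; apply cmean_ext; intros t; unfold H, segm.
  - replace (z + 1 * (zeta r t - z))%C with (zeta r t) by ring. apply Cmult_comm.
  - replace (z + 0 * (zeta r t - z))%C with z by ring. apply Cmult_comm.
Qed.

(** At z = 0 the kernel is identically 1, so the homotopy gives the value outright. The mean of the
    kernel at other points is then derived from this case. *)
Lemma mean_value (f f' : C -> C) (rho r : R) :
  holo_on f f' rho -> 0 < r < rho -> cmean (fun t => f (zeta r t)) = f 0%C.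
Proof.
  intros Hf Hr.
  assert (Hz : Cmod 0%C < r) by (rewrite Cmod_0; lra).
  assert (E1 : forall t, (zeta r t * / (zeta r t - 0))%C = 1%C).
  { intros t. pose proof (zeta_minus_neq 0%C r t Hz) as Hn.
    replace (zeta r t - 0)%C with (zeta r t) in * by ring. apply Cinv_r, Hn. }
  pose proof (cauchy_homotopy f f' rho r 0%C Hf (proj2 Hr) Hz) as E.
  rewrite (cmean_ext (fun t => zeta r t * / (zeta r t - 0))%C (fun _ => 1%C) E1) in E.
  rewrite cmean_const, Cmult_1_r in E. rewrite <- E.
  apply cmean_ext. intros t. rewrite E1. ring.
Qed.

Lemma cderiv_geom (k w : C) : (1 - k * w)%C <> 0 ->
  has_cderiv (fun w => / (1 - k * w))%C w (k * (/ (1 - k * w) * / (1 - k * w)))%C.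
Proof.
  intros H.
  replace (k * (/ (1 - k * w) * / (1 - k * w)))%C with
    ((0 - k) * - (/ (1 - k * w) * / (1 - k * w)))%C by ring.
  apply (has_cderiv_comp Cinv (fun w => 1 - k * w)%C).
  - apply has_cderiv_inv, H.
  - apply has_cderiv_minus. apply has_cderiv_const. apply has_cderiv_scal.
Qed.

Lemma one_minus_neq (k : C) : Cmod k < 1 -> (1 - k)%C <> 0.
Proof.
  intros H. apply Cmod_pos_neq. pose proof (Cmod_triangle_inv 1 k). rewrite Cmod_1 in H0. lra.
Qed.

Lemma holo_geom (k : C) (rho : R) : 0 < rho -> Cmod k * rho <= 1 ->
  holo_on (fun w => / (1 - k * w))%C (fun w => k * (/ (1 - k * w) * / (1 - k * w)))%C rho.
Proof.
  intros H0 Hk w Hw.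
  assert (Hn : (1 - k * w)%C <> 0).
  { apply one_minus_neq. rewrite Cmod_mult. pose proof (Cmod_ge_0 k). pose proof (Cmod_ge_0 w).
    destruct (Req_dec (Cmod k) 0). nra. nra. }
  split. apply cderiv_geom, Hn.
  eapply has_cderiv_ccont. apply has_cderiv_mult. apply has_cderiv_const.
  apply has_cderiv_mult; apply cderiv_geom, Hn.
Qed.

Lemma zeta_conj (r t : R) : (zeta r t * Cconj (zeta r t))%C = RtoC (r * r).
Proof.
  rewrite <- Cmod2_conj. f_equal. rewrite Cmod2_alt. unfold zeta, Re, Im; simpl.
  pose proof (sin2_cos2 t). unfold Rsqr in H. nra.
Qed.

(* On the circle, [zeta / (zeta - z)] is the conjugate of the holomorphic [1 / (1 - conj z * w / r^2)]. *)
Lemma cmean_cauchy_kernel (z : C) (r : R) :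
  Cmod z < r -> cmean (fun t => zeta r t * / (zeta r t - z))%C = 1%C.
Proof.
  intros Hz.
  assert (Hr0 : 0 < r) by (eapply Rle_lt_trans; [apply Cmod_ge_0|exact Hz]).
  assert (Hr2 : RtoC (r * r) <> 0) by (intros E; apply RtoC_inj in E; nra).
  set (k := (Cconj z * / RtoC (r * r))%C).
  (* The geometric kernel is holomorphic up to the radius r^2 / |z|. The radius 2 r - |z| lies
     between r and that one, by (r - |z|)^2 >= 0, and still makes sense at z = 0. *)
  assert (Hk : Cmod k * (2 * r - Cmod z) <= 1).
  { unfold k. rewrite Cmod_mult, Cmod_conj, Cmod_inv, Cmod_R by assumption.
    rewrite Rabs_pos_eq by nra. apply (Rmult_le_reg_r (r * r)). nra.
    replace (Cmod z * / (r * r) * (2 * r - Cmod z) * (r * r)) with (Cmod z * (2 * r - Cmod z)) by (field; lra).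
    nra. }
  assert (Hh := holo_geom k (2 * r - Cmod z) ltac:(lra) Hk).
  assert (Hm := mean_value _ _ (2 * r - Cmod z) r Hh ltac:(lra)).
  simpl in Hm.
  assert (Hcur : ccurve (fun t => zeta r t * / (zeta r t - z))%C).
  { apply ccurve_mult. apply ccurve_zeta. apply ccurve_kernel, Hz. }
  rewrite <- (Cconj_conj (cmean _)), <- cmean_conj by exact Hcur.
  transitivity (Cconj (/ (1 - k * 0))%C).
  2:{ replace (1 - k * 0)%C with (RtoC 1) by ring. rewrite <- RtoC_inv by lra.
      unfold Cconj; simpl. unfold RtoC. f_equal; field. }
  rewrite <- Hm. f_equal. apply cmean_ext. intros t.
  pose proof (zeta_minus_neq z r t Hz) as Hn.
  assert (Hz0 : zeta r t <> 0).
  { apply Cmod_pos_neq. rewrite Cmod_zeta; lra. }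
  assert (Hc0 : Cconj (zeta r t) <> 0).
  { apply Cmod_pos_neq. rewrite Cmod_conj, Cmod_zeta; lra. }
  assert (Hcn : (Cconj (zeta r t) - Cconj z)%C <> 0).
  { rewrite <- Cminus_conj. apply Cmod_pos_neq. rewrite Cmod_conj. apply Cmod_gt_0, Hn. }
  rewrite Cmult_conj, Cinv_conj, Cminus_conj by exact Hn.
  unfold k. rewrite <- (zeta_conj r t). field.
  repeat split; try assumption.
Qed.

Lemma cauchy_formula (f f' : C -> C) (rho r : R) (z : C) :
  holo_on f f' rho -> r < rho -> Cmod z < r ->
  f z = cmean (fun t => f (zeta r t) * (zeta r t * / (zeta r t - z)))%C.
Proof.
  intros Hf Hr Hz. rewrite (cauchy_homotopy f f' rho r z Hf Hr Hz).
  rewrite cmean_cauchy_kernel by exact Hz. ring.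
Qed.

(** * Cauchy integrals and higher derivatives *)

(** Here a = 1 / (zeta - z - h) and b = 1 / (zeta - z), for which a - b = h a b. The errors satisfy
    E_(m+1) = a E_m + (m+1) h^2 a b^(m+2), so the coefficients add up to the triangular number m
    (m+1) / 2. *)
Lemma inv_power_taylor (a b h : C) (B : R) (m : nat) :
  (a - b)%C = (h * a * b)%C -> Cmod a <= B -> Cmod b <= B ->
  Cmod (a ^ m - b ^ m - RtoC (INR m) * h * b ^ (S m)) <=
  INR m * (INR m + 1) / 2 * B ^ (m + 2) * Cmod h ^ 2.
Proof.
  intros Hab Ha Hb. pose proof (Cmod_ge_0 a) as Ha0. pose proof (Cmod_ge_0 b) as Hb0.
  pose proof (Cmod_ge_0 h) as Hh0.
  induction m as [|m IH].
  - simpl. replace (1 - 1 - 0 * h * (b * 1))%C with (RtoC 0) by ring.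
    rewrite Cmod_0. right. field.
  - replace (a ^ S m - b ^ S m - RtoC (INR (S m)) * h * b ^ S (S m))%C with
      (a * (a ^ m - b ^ m - RtoC (INR m) * h * b ^ S m)
       + RtoC (INR (S m)) * (h * h) * (a * b ^ (m + 2)))%C.
    + eapply Rle_trans. apply Cmod_triangle. rewrite !Cmod_mult, Cmod_pow, Cmod_R.
      rewrite Rabs_pos_eq by apply pos_INR.
      assert (Hp : Cmod b ^ (m + 2) <= B ^ (m + 2)) by (apply pow_incr; lra).
      assert (Hp0 : 0 <= Cmod b ^ (m + 2)) by (apply pow_le; lra).
      assert (P1 : Cmod a * Cmod (a ^ m - b ^ m - RtoC (INR m) * h * b ^ S m) <=
        B * (INR m * (INR m + 1) / 2 * B ^ (m + 2) * Cmod h ^ 2)).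
      { apply Rmult_le_compat; [lra|apply Cmod_ge_0|lra|exact IH]. }
      assert (P2 : Cmod a * Cmod b ^ (m + 2) <= B * B ^ (m + 2)).
      { apply Rmult_le_compat; lra. }
      rewrite S_INR in *. pose proof (pos_INR m).
      assert (P3 : (INR m + 1) * (Cmod h * Cmod h) * (Cmod a * Cmod b ^ (m + 2)) <=
        (INR m + 1) * (Cmod h * Cmod h) * (B * B ^ (m + 2))).
      { apply Rmult_le_compat_l; [|exact P2]. apply Rmult_le_pos; nra. }
      eapply Rle_trans. apply Rplus_le_compat; [exact P1|exact P3].
      right. simpl. field.
    + assert (E : a = (b + h * a * b)%C) by (rewrite <- Hab; ring).
      replace (m + 2)%nat with (S (S m)) by lia.
      rewrite S_INR, RtoC_plus. simpl Cpow.
      assert (E2 : (a * b ^ m - b ^ m * b)%C = (h * a * (b ^ m * b))%C).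
      { transitivity ((a - b) * b ^ m)%C. ring. rewrite Hab. ring. }
      assert (E3 : (h * (b ^ m * b) * a - h * (b ^ m * b) * b)%C = (h * h * a * (b ^ m * b * b))%C).
      { transitivity (h * (b ^ m * b) * (a - b))%C. ring. rewrite Hab. ring. }
      set (p := (b ^ m)%C) in *. set (q := (a ^ m)%C). set (n := RtoC (INR m)).
      transitivity (a * q - b * p - (n + 1) * h * (b * (b * p)) +
         ((b * p - a * p + h * a * (p * b)) +
         (n + 1) * (h * h * a * (p * b * b) - (h * (p * b) * a - h * (p * b) * b))))%C.
      ring. rewrite E3.
      replace (b * p - a * p + h * a * (p * b))%C with (h * a * (p * b) - (a * p - p * b))%C by ring.
      rewrite E2. ring.
Qed.

(** For m >= 1 this is the derivative of order m - 1 of the Cauchy integral of the density [u],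
    divided by (m - 1)!. The factor [zeta r t] comes from d zeta = i zeta dt. *)
Definition Kint (m : nat) (u : R -> C) (r : R) (z : C) : C :=
  cmean (fun t => u t * (zeta r t * (/ (zeta r t - z)) ^ m))%C.

Definition L1_mean (u : R -> C) : R := rmean (fun t => Cmod (u t)).

Lemma Cmod_zeta_inv (r s t : R) (z : C) :
  s < r -> Cmod z <= s -> Cmod (/ (zeta r t - z)) <= / (r - s).
Proof.
  intros Hs Hz. pose proof (Cmod_ge_0 z).
  rewrite Cmod_inv by (apply zeta_minus_neq; lra).
  apply Rinv_le_contravar. lra.
  pose proof (Cmod_triangle_inv (zeta r t) z). rewrite Cmod_zeta in H0; lra.
Qed.

Lemma ccurve_Kint (m : nat) (u : R -> C) (r : R) (z : C) :
  ccurve u -> Cmod z < r -> ccurve (fun t => u t * (zeta r t * (/ (zeta r t - z)) ^ m))%C.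
Proof.
  intros Hu Hz. apply ccurve_mult; [exact Hu|]. apply ccurve_mult. apply ccurve_zeta.
  apply ccurve_pow, ccurve_kernel, Hz.
Qed.

Lemma Kint_bound (m : nat) (u : R -> C) (r s : R) (z : C) :
  ccurve u -> s < r -> Cmod z <= s ->
  Cmod (Kint m u r z) <= L1_mean u * (r * (/ (r - s)) ^ m).
Proof.
  intros Hu Hs Hz. pose proof (Cmod_ge_0 z).
  pose proof (rcont_Cmod u Hu) as Hc.
  rewrite Rmult_comm. unfold L1_mean. rewrite <- rmean_scal by exact Hc.
  apply Cmod_cmean_le.
  - apply ccurve_Kint. exact Hu. lra.
  - apply rcont_mult. apply rcont_const. exact Hc.
  - intros t. rewrite !Cmod_mult, Cmod_pow, Cmod_zeta by lra. rewrite Rmult_comm.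
    apply Rmult_le_compat_r. apply Cmod_ge_0. apply Rmult_le_compat_l. lra.
    apply pow_incr. split. apply Cmod_ge_0. apply Cmod_zeta_inv; assumption.
Qed.

(** The expansion of the kernel is integrated against [u]. The constant sees [u] only through its L1
    mean; this later makes the Taylor remainder uniform along a bounded sequence and lets it pass to
    the limit. *)
Lemma Kint_taylor (m : nat) (u : R -> C) (r s : R) (z h : C) :
  ccurve u -> s < r -> Cmod z <= s -> Cmod (z + h) <= s ->
  Cmod (Kint m u r (z + h) - Kint m u r z - RtoC (INR m) * Kint (S m) u r z * h) <=
  L1_mean u * (r * (INR m * (INR m + 1) / 2 * (/ (r - s)) ^ (m + 2))) * Cmod h ^ 2.
Proof.
  intros Hu Hs Hz Hzh. pose proof (Cmod_ge_0 z) as H0.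
  pose proof (rcont_Cmod u Hu) as Hc.
  assert (C1 := ccurve_Kint m u r z Hu ltac:(lra)).
  assert (C2 := ccurve_Kint m u r (z + h)%C Hu ltac:(lra)).
  assert (C3 := ccurve_Kint (S m) u r z Hu ltac:(lra)).
  replace (RtoC (INR m) * Kint (S m) u r z * h)%C with (RtoC (INR m) * h * Kint (S m) u r z)%C by ring.
  unfold Kint. rewrite <- cmean_scal by exact C3.
  rewrite <- cmean_minus by assumption.
  assert (C4 := ccurve_minus _ _ C2 C1).
  assert (C5 := ccurve_mult _ _ (ccurve_const (RtoC (INR m) * h)%C) C3).
  rewrite <- cmean_minus by assumption.
  set (Q := r * (INR m * (INR m + 1) / 2 * (/ (r - s)) ^ (m + 2))).
  replace (L1_mean u * Q * Cmod h ^ 2) with (Q * Cmod h ^ 2 * L1_mean u) by ring.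
  unfold L1_mean. rewrite <- rmean_scal by exact Hc.
  apply Cmod_cmean_le.
  - apply ccurve_minus; assumption.
  - apply rcont_mult. apply rcont_const. exact Hc.
  - intros t. set (a := (/ (zeta r t - (z + h)))%C). set (b := (/ (zeta r t - z))%C).
    replace (u t * (zeta r t * a ^ m) - u t * (zeta r t * b ^ m) - RtoC (INR m) * h * (u t * (zeta r t * b ^ S m)))%C
      with (u t * zeta r t * (a ^ m - b ^ m - RtoC (INR m) * h * b ^ S m))%C by ring.
    rewrite !Cmod_mult, Cmod_zeta by lra.
    pose proof (Cmod_ge_0 (u t)).
    apply Rle_trans with (Cmod (u t) * r * (INR m * (INR m + 1) / 2 * (/ (r - s)) ^ (m + 2) * Cmod h ^ 2)).
    + apply Rmult_le_compat_l. apply Rmult_le_pos; lra.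
      apply inv_power_taylor.
      * unfold a, b. field. split; apply zeta_minus_neq; lra.
      * apply Cmod_zeta_inv; assumption.
      * apply Cmod_zeta_inv; assumption.
    + right. unfold Q. ring.
Qed.

Lemma has_cderiv_quadratic (f : C -> C) (z l : C) (d Q : R) :
  0 < d -> (forall h, Cmod h < d -> Cmod (f (z + h)%C - f z - l * h) <= Q * Cmod h ^ 2) ->
  has_cderiv f z l.
Proof.
  intros Hd H. apply has_cderiv_iff. intros eps He.
  assert (Hq : 0 < Rabs Q + 1) by (pose proof (Rabs_pos Q); lra).
  assert (Hp : 0 < eps / (Rabs Q + 1)) by (apply Rdiv_lt_0_compat; lra).
  exists (Rmin d (eps / (Rabs Q + 1))). split. apply Rmin_pos; assumption.
  intros w Hw.
  assert (H1 := Rlt_le_trans _ _ _ Hw (Rmin_l _ _)).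
  assert (H2 := Rlt_le_trans _ _ _ Hw (Rmin_r _ _)).
  specialize (H (w - z)%C H1). replace (z + (w - z))%C with w in H by ring.
  eapply Rle_trans. exact H.
  pose proof (Cmod_ge_0 (w - z)) as H3.
  apply Rle_trans with ((Rabs Q + 1) * Cmod (w - z) ^ 2).
  - apply Rmult_le_compat_r. apply pow_le, H3. pose proof (Rle_abs Q). lra.
  - simpl. rewrite Rmult_1_r, <- Rmult_assoc. apply Rmult_le_compat_r. exact H3.
    apply Rle_trans with ((Rabs Q + 1) * (eps / (Rabs Q + 1))).
    + apply Rmult_le_compat_l; lra.
    + right. field. lra.
Qed.

Lemma Kint_deriv (m : nat) (u : R -> C) (r : R) (z : C) :
  ccurve u -> Cmod z < r -> has_cderiv (Kint m u r) z (RtoC (INR m) * Kint (S m) u r z)%C.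
Proof.
  intros Hu Hz.
  eapply (has_cderiv_quadratic _ _ _ ((r - Cmod z) / 2)). lra.
  intros h Hh. apply (Kint_taylor m u r ((r + Cmod z) / 2)); try assumption; try lra.
  eapply Rle_trans. apply Cmod_triangle. lra.
Qed.

(** Two complex derivatives make f' continuous, as [holo_on] demands; every member of S^p has them
    by definition. *)
Definition holo2 (f : C -> C) : Prop := analytic_on_disk f /\ analytic_on_disk (cderiv f).

Lemma disk_open (z : C) : in_disk z -> 0 < 1 - Cmod z /\
  forall w, Cmod (w - z) < 1 - Cmod z -> in_disk w.
Proof.
  intros Hz. unfold in_disk in *. split. lra. intros w Hw.
  pose proof (Cmod_triangle_inv w z). lra.
Qed.

Lemma has_cderiv_ext_disk (f g : C -> C) (z l : C) :
  (forall w, in_disk w -> f w = g w) -> in_disk z -> has_cderiv f z l -> has_cderiv g z l.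
Proof.
  intros H Hz. destruct (disk_open z Hz) as [H1 H2].
  apply (has_cderiv_ext_near f g z l _ H1). intros w Hw. apply H, H2, Hw.
Qed.

Lemma analytic_ext (f g : C -> C) :
  (forall w, in_disk w -> f w = g w) -> analytic_on_disk f -> analytic_on_disk g.
Proof.
  intros H Hf z Hz. destruct (Hf z Hz) as [l Hl]. exists l.
  apply (has_cderiv_ext_disk f g z l H Hz Hl).
Qed.

Lemma holo2_holo_on (f : C -> C) : holo2 f -> holo_on f (cderiv f) 1.
Proof.
  intros [H1 H2] w Hw. split. apply cderiv_correct, H1, Hw.
  destruct (H2 w Hw) as [l Hl]. apply (has_cderiv_ccont _ _ _ Hl).
Qed.

Lemma analytic_circle (f : C -> C) (r : R) :
  analytic_on_disk f -> 0 <= r < 1 -> ccurve (fun t => f (zeta r t)).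
Proof.
  intros Hf Hr. apply ccont_ccurve; [|apply ccurve_zeta]. intros t.
  destruct (Hf (zeta r t)) as [l Hl]. unfold in_disk. rewrite Cmod_zeta; lra.
  apply (has_cderiv_ccont _ _ _ Hl).
Qed.

Lemma holo2_repr (f : C -> C) (r : R) (z : C) :
  holo2 f -> r < 1 -> Cmod z < r -> f z = Kint 1 (fun t => f (zeta r t)) r z.
Proof.
  intros Hf Hr Hz.
  rewrite (cauchy_formula f (cderiv f) 1 r z (holo2_holo_on f Hf) Hr Hz).
  apply cmean_ext. intros t. simpl. rewrite Cmult_1_r. reflexivity.
Qed.

Lemma holo2_cderiv_repr (f : C -> C) (r : R) (z : C) :
  holo2 f -> r < 1 -> Cmod z < r -> cderiv f z = Kint 2 (fun t => f (zeta r t)) r z.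
Proof.
  intros Hf Hr Hz. pose proof (Cmod_ge_0 z) as H0.
  apply cderiv_unique.
  apply (has_cderiv_ext_near (Kint 1 (fun t => f (zeta r t)) r) f z _ (r - Cmod z)). lra.
  - intros w Hw. symmetry. apply holo2_repr; try assumption.
    pose proof (Cmod_triangle_inv w z). lra.
  - replace (Kint 2 (fun t => f (zeta r t)) r z) with
      (RtoC (INR 1) * Kint 2 (fun t => f (zeta r t)) r z)%C by (simpl; ring).
    apply Kint_deriv. apply analytic_circle. apply Hf. lra. exact Hz.
Qed.

(** Cauchy's formula bootstraps: near each point f'' is twice the kernel integral [Kint 3] of
    boundary values of f, hence differentiable again. By iteration derivatives of every order
    exist. *)
Lemma holo2_cderiv (f : C -> C) : holo2 f -> holo2 (cderiv f).
Proof.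
  intros Hf. split. apply Hf. intros z Hz. unfold in_disk in Hz.
  pose proof (Cmod_ge_0 z) as H0.
  set (r := (1 + Cmod z) / 2). assert (Hr : Cmod z < r /\ r < 1) by (unfold r; lra).
  set (u := fun t => f (zeta r t)).
  assert (Hu : ccurve u) by (apply analytic_circle; [apply Hf|lra]).
  assert (E : forall w, Cmod w < r -> cderiv (cderiv f) w = (2 * Kint 3 u r w)%C).
  { intros w Hw. apply cderiv_unique.
    apply (has_cderiv_ext_near (Kint 2 u r) (cderiv f) w _ (r - Cmod w)). lra.
    - intros v Hv. symmetry. apply holo2_cderiv_repr. exact Hf. lra.
      pose proof (Cmod_triangle_inv v w). lra.
    - replace (RtoC 2) with (RtoC (INR 2)) by (simpl; f_equal; ring). apply Kint_deriv. exact Hu. exact Hw. }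
  eexists.
  apply (has_cderiv_ext_near (fun w => 2 * Kint 3 u r w)%C (cderiv (cderiv f)) z _ (r - Cmod z)). lra.
  - intros v Hv. symmetry. apply E. pose proof (Cmod_triangle_inv v z). lra.
  - apply (has_cderiv_comp (fun v => 2 * v)%C (Kint 3 u r)). apply has_cderiv_scal.
    apply Kint_deriv. exact Hu. lra.
Qed.

Lemma L1_mean_le (u : R -> C) (M : R) : ccurve u -> (forall t, Cmod (u t) <= M) -> L1_mean u <= M.
Proof.
  intros Hu H. rewrite <- (rmean_const M). apply rmean_le. apply rcont_Cmod, Hu.
  apply rcont_const. exact H.
Qed.

Lemma cderiv_bound (f : C -> C) (r s M : R) (z : C) :
  holo2 f -> r < 1 -> s < r -> Cmod z <= s -> (forall t, Cmod (f (zeta r t)) <= M) ->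
  Cmod (cderiv f z) <= M * (r * (/ (r - s)) ^ 2).
Proof.
  intros Hf Hr Hs Hz HM. pose proof (Cmod_ge_0 z) as H0.
  assert (Hu : ccurve (fun t => f (zeta r t))) by (apply analytic_circle; [apply Hf|lra]).
  rewrite (holo2_cderiv_repr f r z Hf Hr) by lra.
  eapply Rle_trans. apply (Kint_bound 2 _ r s z Hu Hs Hz).
  apply Rmult_le_compat_r. apply Rmult_le_pos. lra. apply pow_le. left. apply Rinv_0_lt_compat. lra.
  apply L1_mean_le; assumption.
Qed.

Lemma cderiv_taylor (f : C -> C) (r s M : R) (z h : C) :
  holo2 f -> r < 1 -> s < r -> Cmod z <= s -> Cmod (z + h) <= s ->
  (forall t, Cmod (f (zeta r t)) <= M) ->
  Cmod (f (z + h)%C - f z - cderiv f z * h) <= M * (r * (/ (r - s)) ^ 3) * Cmod h ^ 2.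
Proof.
  intros Hf Hr Hs Hz Hzh HM. pose proof (Cmod_ge_0 z) as H0.
  assert (Hu : ccurve (fun t => f (zeta r t))) by (apply analytic_circle; [apply Hf|lra]).
  rewrite (holo2_cderiv_repr f r z Hf Hr) by lra.
  rewrite (holo2_repr f r z Hf Hr), (holo2_repr f r (z + h)%C Hf Hr) by lra.
  pose proof (Kint_taylor 1 _ r s z h Hu Hs Hz Hzh) as H.
  simpl INR in H. rewrite Cmult_1_l in H. eapply Rle_trans. exact H.
  apply Rmult_le_compat_r. apply pow_le, Cmod_ge_0.
  replace (1 * (1 + 1) / 2) with 1 by field. rewrite Rmult_1_l.
  apply Rmult_le_compat_r. apply Rmult_le_pos. lra. apply pow_le. left. apply Rinv_0_lt_compat. lra.
  apply L1_mean_le; assumption.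
Qed.

Lemma cderiv_minus (f g : C -> C) (z : C) :
  analytic_on_disk f -> analytic_on_disk g -> in_disk z ->
  cderiv (fun w => f w - g w)%C z = (cderiv f z - cderiv g z)%C.
Proof.
  intros Hf Hg Hz. apply cderiv_unique, has_cderiv_minus; apply cderiv_correct; auto.
Qed.

Lemma analytic_minus (f g : C -> C) :
  analytic_on_disk f -> analytic_on_disk g -> analytic_on_disk (fun w => f w - g w)%C.
Proof.
  intros Hf Hg z Hz. destruct (Hf z Hz), (Hg z Hz). eexists. apply has_cderiv_minus; eassumption.
Qed.

Lemma holo2_minus (f g : C -> C) : holo2 f -> holo2 g -> holo2 (fun w => f w - g w)%C.
Proof.
  intros [Hf Hf'] [Hg Hg']. split. apply analytic_minus; assumption.
  apply (analytic_ext (fun w => cderiv f w - cderiv g w)%C).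
  - intros w Hw. symmetry. apply cderiv_minus; assumption.
  - apply analytic_minus; assumption.
Qed.

(** * Poisson formula and point evaluations *)

Lemma rpow_eq (x p : R) : 0 < x -> rpow x p = Rpower x p.
Proof. intros H. unfold rpow. destruct (Rlt_dec 0 x); [reflexivity|lra]. Qed.

Lemma rpow_0 (x p : R) : x <= 0 -> rpow x p = 0.
Proof. intros H. unfold rpow. destruct (Rlt_dec 0 x); [lra|reflexivity]. Qed.

Lemma rpow_pos (x p : R) : 0 < x -> 0 < rpow x p.
Proof. intros H. rewrite rpow_eq by exact H. apply exp_pos. Qed.

Lemma rpow_nonneg (x p : R) : 0 <= rpow x p.
Proof.
  destruct (Rlt_dec 0 x). left. apply rpow_pos; assumption. rewrite rpow_0; lra.
Qed.

Lemma rpow_le (x y p : R) : 0 <= p -> x <= y -> rpow x p <= rpow y p.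
Proof.
  intros Hp H. destruct (Rlt_dec 0 x) as [Hx|Hx].
  - rewrite !rpow_eq by lra. apply Rle_Rpower_l; lra.
  - rewrite (rpow_0 x) by lra. apply rpow_nonneg.
Qed.

Lemma rpow_mult (x y p : R) : 0 <= x -> 0 <= y -> rpow (x * y) p = rpow x p * rpow y p.
Proof.
  intros Hx Hy. destruct (Req_dec x 0) as [->|Hx0].
  { rewrite Rmult_0_l, !(rpow_0 0) by lra. ring. }
  destruct (Req_dec y 0) as [->|Hy0].
  { rewrite Rmult_0_r, !(rpow_0 0) by lra. ring. }
  rewrite !rpow_eq; try lra. symmetry. apply Rpower_mult_distr; lra.
  apply Rmult_lt_0_compat; lra.
Qed.

Lemma rpow_rpow (x p q : R) : rpow (rpow x p) q = rpow x (p * q).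
Proof.
  destruct (Rlt_dec 0 x) as [Hx|Hx].
  - rewrite (rpow_eq (rpow x p)) by (apply rpow_pos, Hx). rewrite !rpow_eq by exact Hx. apply Rpower_mult.
  - rewrite (rpow_0 x p), (rpow_0 x (p * q)) by lra. apply rpow_0. lra.
Qed.

Lemma rpow_1 (x : R) : 0 <= x -> rpow x 1 = x.
Proof.
  intros H. destruct (Req_dec x 0) as [->|Hx]. apply rpow_0; lra.
  rewrite rpow_eq by lra. apply Rpower_1. lra.
Qed.

Lemma rpow_base_1 (p : R) : rpow 1 p = 1.
Proof. rewrite rpow_eq by lra. unfold Rpower. rewrite ln_1, Rmult_0_r. apply exp_0. Qed.

Lemma continuous_rpow (p x : R) : 0 < p -> continuous (fun y => rpow y p) x.
Proof.
  intros Hp. destruct (Rlt_dec 0 x) as [Hx|Hx].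
  - apply (continuous_ext_loc (fun y => rpow y p) (fun y => exp (p * ln y))).
    + exists (mkposreal x Hx). intros y Hy.
      change (Rabs (y - x) < x) in Hy. apply Rabs_def2 in Hy. rewrite rpow_eq by lra. reflexivity.
    + apply (ex_derive_continuous (K := R_AbsRing) (V := R_NormedModule)).
      auto_derive. exact Hx.
  - apply filterlim_locally. intros eps.
    exists (mkposreal _ (rpow_pos eps (/ p) (cond_pos eps))). intros y Hy.
    change (Rabs (y - x) < rpow eps (/ p)) in Hy. apply Rabs_def2 in Hy.
    change (Rabs (rpow y p - rpow x p) < eps). rewrite (rpow_0 x) by lra.
    rewrite Rminus_0_r, Rabs_pos_eq by apply rpow_nonneg.
    destruct (Rlt_dec 0 y) as [H|H].
    + apply Rlt_le_trans with (rpow (rpow eps (/ p)) p).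
      * rewrite !(rpow_eq _ p); try lra. apply Rlt_Rpower_l; lra.
      * rewrite rpow_rpow, Rinv_l by lra. right. apply rpow_1. left. apply cond_pos.
    + rewrite rpow_0 by lra. apply cond_pos.
Qed.

Lemma rcont_rpow (u : R -> R) (p : R) : 0 < p -> rcont u -> rcont (fun t => rpow (u t) p).
Proof.
  intros Hp Hu t. apply (continuous_comp u (fun y => rpow y p)). apply Hu.
  apply continuous_rpow, Hp.
Qed.

(** Estimates run on real bounds for all radii, and the extended supremum is met only when passing
    to or from [Hp_norm]. A bound of the form [rpow K p] expresses that the norm is at most [K]. *)
Definition mean_bound (p : R) (g : C -> C) (B : R) : Prop :=
  forall r, 0 < r < 1 -> mean_p p g r <= B.

Lemma mean_p_rmean (p : R) (g : C -> C) (r : R) :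
  mean_p p g r = rmean (fun t => rpow (Cmod (g (zeta r t))) p).
Proof. reflexivity. Qed.

Lemma rcont_mean_p (p : R) (g : C -> C) (r : R) :
  0 < p -> analytic_on_disk g -> 0 <= r < 1 -> rcont (fun t => rpow (Cmod (g (zeta r t))) p).
Proof. intros Hp Hg Hr. apply rcont_rpow, rcont_Cmod, analytic_circle; assumption. Qed.

Lemma mean_p_nonneg (p : R) (g : C -> C) (r : R) :
  0 < p -> analytic_on_disk g -> 0 <= r < 1 -> 0 <= mean_p p g r.
Proof.
  intros Hp Hg Hr. rewrite mean_p_rmean, <- (rmean_const 0). apply rmean_le.
  apply rcont_const. apply rcont_mean_p; assumption. intros t. apply rpow_nonneg.
Qed.

Lemma in_Hp_finite (p : R) (g : C -> C) :
  0 < p -> in_Hp p g -> exists s, Hp_sup p g = Finite s /\ 0 <= s /\ mean_bound p g s.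
Proof.
  intros Hp [Hg Hs].
  destruct (Lub_Rbar_correct (fun x => exists r, 0 < r < 1 /\ x = mean_p p g r)) as [Hub _].
  fold (Hp_sup p g) in Hub.
  assert (H : forall r, 0 < r < 1 -> Rbar_le (mean_p p g r) (Hp_sup p g)).
  { intros r Hr. apply Hub. exists r. auto. }
  (* One sample radius rules out the value minus infinity and shows that the supremum is
     nonnegative. *)
  assert (H2 := H (/ 2) ltac:(lra)).
  destruct (Hp_sup p g) as [s| |]; simpl in Hs, H2; try contradiction.
  exists s. split; [reflexivity|]. split.
  - eapply Rle_trans; [|exact H2]. apply mean_p_nonneg; auto; lra.
  - exact H.
Qed.

Lemma in_Hp_mean_bound (p : R) (g : C -> C) (M : R) :
  0 < p -> in_Hp p g -> Hp_norm p g <= M -> mean_bound p g (rpow M p).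
Proof.
  intros Hp Hg HM r Hr. destruct (in_Hp_finite p g Hp Hg) as [s [Es [Hs Hb]]].
  eapply Rle_trans. apply Hb, Hr. unfold Hp_norm in HM. rewrite Es in HM. simpl in HM.
  apply Rle_trans with (rpow (rpow s (/ p)) p).
  - rewrite rpow_rpow, Rinv_l, rpow_1; lra.
  - apply rpow_le; lra.
Qed.

Lemma mean_bound_Hp (p : R) (g : C -> C) (M : R) :
  0 < p -> 0 <= M -> analytic_on_disk g -> mean_bound p g (rpow M p) ->
  in_Hp p g /\ Hp_norm p g <= M.
Proof.
  intros Hp HM Hg Hb.
  assert (Hle : Rbar_le (Hp_sup p g) (rpow M p)).
  { apply (proj2 (Lub_Rbar_correct (fun x => exists r, 0 < r < 1 /\ x = mean_p p g r))).
    intros x [r [Hr ->]]. apply Hb, Hr. }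
  assert (Hin : in_Hp p g).
  { split. exact Hg. eapply Rbar_le_lt_trans. exact Hle. exact I. }
  split. exact Hin. destruct (in_Hp_finite p g Hp Hin) as [s [Es [Hs _]]].
  unfold Hp_norm. rewrite Es in *. simpl in *.
  apply Rle_trans with (rpow (rpow M p) (/ p)).
  - apply rpow_le; [|exact Hle]. left. apply Rinv_0_lt_compat, Hp.
  - rewrite rpow_rpow, Rinv_r, rpow_1; lra.
Qed.

Lemma Hp_norm_nonneg (p : R) (g : C -> C) : 0 <= Hp_norm p g.
Proof. apply rpow_nonneg. Qed.

Lemma ccont_mult (f g : C -> C) (z : C) : ccont f z -> ccont g z -> ccont (fun w => f w * g w)%C z.
Proof.
  assert (E : forall h : C -> C, ccont h z <->
     @continuous (AbsRing_UniformSpace C_AbsRing) (AbsRing_UniformSpace C_AbsRing) h z).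
  { intros h. split.
    - intros H. apply filterlim_locally. intros eps. destruct (H eps (cond_pos eps)) as [d [Hd Hw]].
      exists (mkposreal d Hd). exact Hw.
    - intros H eps He. destruct (proj1 (filterlim_locally _ _) H (mkposreal eps He)) as [d Hw].
      exists d. split. apply cond_pos. exact Hw. }
  intros Hf Hg. apply E in Hf. apply E in Hg. apply E.
  exact (continuous_mult (U := AbsRing_UniformSpace C_AbsRing) (K := C_AbsRing) f g z Hf Hg).
Qed.

Lemma ccont_plus (f g : C -> C) (z : C) : ccont f z -> ccont g z -> ccont (fun w => f w + g w)%C z.
Proof.
  intros Hf Hg eps He.
  destruct (Hf (eps / 2)) as [d1 [H1 A1]]. lra. destruct (Hg (eps / 2)) as [d2 [H2 A2]]. lra.
  exists (Rmin d1 d2). split. apply Rmin_pos; assumption. intros w Hw.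
  specialize (A1 w (Rlt_le_trans _ _ _ Hw (Rmin_l _ _))).
  specialize (A2 w (Rlt_le_trans _ _ _ Hw (Rmin_r _ _))).
  replace (f w + g w - (f z + g z))%C with ((f w - f z) + (g w - g z))%C by ring.
  eapply Rle_lt_trans. apply Cmod_triangle. lra.
Qed.

Lemma ccont_const (c z : C) : ccont (fun _ => c) z.
Proof. exact (has_cderiv_ccont _ _ _ (has_cderiv_const c z)). Qed.

Lemma holo_mult (f f' g g' : C -> C) (rho : R) :
  holo_on f f' rho -> holo_on g g' rho ->
  holo_on (fun w => f w * g w)%C (fun w => f' w * g w + f w * g' w)%C rho.
Proof.
  intros Hf Hg w Hw. destruct (Hf w Hw) as [H1 H2]. destruct (Hg w Hw) as [H3 H4].
  pose proof (has_cderiv_ccont _ _ _ H1). pose proof (has_cderiv_ccont _ _ _ H3).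
  split. apply has_cderiv_mult; assumption.
  apply ccont_plus; apply ccont_mult; assumption.
Qed.

Lemma holo_on_le (f f' : C -> C) (rho rho' : R) :
  rho' <= rho -> holo_on f f' rho -> holo_on f f' rho'.
Proof. intros H Hf w Hw. apply Hf. lra. Qed.

Definition poisson (z : C) (r t : R) : R :=
  (r * r - Cmod z * Cmod z) * / (Cmod (zeta r t - z) ^ 2).

Lemma rcont_poisson (z : C) (r : R) : Cmod z < r -> rcont (poisson z r).
Proof.
  intros Hz. apply rcont_mult. apply rcont_const.
  assert (H : rcont (fun t => Cmod (zeta r t - z))).
  { apply rcont_Cmod. apply ccurve_minus. apply ccurve_zeta. apply ccurve_const. }
  apply rcont_inv.
  - intros t. apply pow_nonzero, Rgt_not_eq, Cmod_gt_0, zeta_minus_neq, Hz.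
  - simpl. apply rcont_mult. exact H. apply rcont_mult. exact H. apply rcont_const.
Qed.

Lemma poisson_pos (z : C) (r t : R) : Cmod z < r -> 0 < poisson z r t.
Proof.
  intros Hz. pose proof (Cmod_ge_0 z). apply Rmult_lt_0_compat. nra.
  apply Rinv_0_lt_compat, pow_lt, Cmod_gt_0, zeta_minus_neq, Hz.
Qed.

Lemma poisson_le (z : C) (r t : R) : Cmod z < r -> poisson z r t <= (r + Cmod z) / (r - Cmod z).
Proof.
  intros Hz. pose proof (Cmod_ge_0 z). unfold poisson.
  pose proof (Cmod_triangle_inv (zeta r t) z) as Ht. rewrite Cmod_zeta in Ht by lra.
  apply Rle_trans with ((r * r - Cmod z * Cmod z) * / (r - Cmod z) ^ 2).
  - apply Rmult_le_compat_l. nra. apply Rinv_le_contravar. apply pow_lt; lra. apply pow_incr; lra.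
  - right. field. lra.
Qed.

(* Cauchy's formula for [f w * (r^2 - |z|^2) / (r^2 - conj z * w)]. *)
Lemma poisson_formula (f f' : C -> C) (rho r : R) (z : C) :
  holo_on f f' rho -> r < rho -> Cmod z < r ->
  f z = cmean (fun t => f (zeta r t) * RtoC (poisson z r t))%C.
Proof.
  intros Hf Hr Hz. pose proof (Cmod_ge_0 z) as H0.
  assert (Hr2 : RtoC (r * r) <> 0) by (intros E; apply RtoC_inj in E; nra).
  set (k := (Cconj z * / RtoC (r * r))%C).
  assert (Hk : Cmod k * (2 * r - Cmod z) <= 1).
  { unfold k. rewrite Cmod_mult, Cmod_conj, Cmod_inv, Cmod_R by assumption.
    rewrite Rabs_pos_eq by nra. apply (Rmult_le_reg_r (r * r)). nra.
    replace (Cmod z * / (r * r) * (2 * r - Cmod z) * (r * r)) with (Cmod z * (2 * r - Cmod z)) by (field; lra).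
    nra. }
  assert (Hh := holo_geom k (2 * r - Cmod z) ltac:(lra) Hk).
  set (rho' := Rmin rho (2 * r - Cmod z)).
  assert (Hr' : r < rho') by (apply Rmin_glb_lt; lra).
  assert (HG := holo_mult _ _ _ _ rho' (holo_on_le _ _ _ _ (Rmin_l _ _) Hf) (holo_on_le _ _ _ _ (Rmin_r _ _) Hh)).
  assert (HC := cauchy_formula _ _ rho' r z HG Hr' Hz). simpl in HC.
  assert (Hzz : (z * Cconj z)%C = RtoC (Cmod z * Cmod z)).
  { rewrite <- Cmod2_conj. f_equal. ring. }
  assert (Hkz : (1 - k * z)%C = RtoC ((r * r - Cmod z * Cmod z) / (r * r))).
  { rewrite RtoC_div by nra. rewrite RtoC_minus, <- Hzz. unfold k. field. exact Hr2. }
  set (q := (r * r - Cmod z * Cmod z) / (r * r)) in *.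
  assert (Hq : 0 < q) by (apply Rdiv_lt_0_compat; nra).
  assert (HqC : RtoC q <> 0) by (intros E; apply RtoC_inj in E; lra).
  transitivity (RtoC q * (f z * / (1 - k * z)))%C.
  { rewrite Hkz. field. exact HqC. }
  rewrite HC. rewrite <- cmean_scal.
  - apply cmean_ext. intros t.
    pose proof (zeta_minus_neq z r t Hz) as Hn.
    assert (Hz0 : zeta r t <> 0) by (apply Cmod_pos_neq; rewrite Cmod_zeta; lra).
    assert (Hc0 : Cconj (zeta r t) <> 0) by (apply Cmod_pos_neq; rewrite Cmod_conj, Cmod_zeta; lra).
    assert (Hcn : (Cconj (zeta r t) - Cconj z)%C <> 0).
    { rewrite <- Cminus_conj. apply Cmod_pos_neq. rewrite Cmod_conj. apply Cmod_gt_0, Hn. }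
    unfold poisson, q. rewrite RtoC_mult, RtoC_inv, Cmod2_conj, Cminus_conj.
    2:{ apply pow_nonzero, Rgt_not_eq, Cmod_gt_0, Hn. }
    rewrite RtoC_div by nra. unfold k. rewrite <- (zeta_conj r t). field.
    repeat split; assumption.
  - apply ccurve_mult.
    + apply (ccont_ccurve (fun w => f w * / (1 - k * w))%C); [|apply ccurve_zeta].
      intros t. eapply has_cderiv_ccont. apply HG. rewrite Cmod_zeta; lra.
    + apply ccurve_mult. apply ccurve_zeta. apply ccurve_kernel, Hz.
Qed.

Lemma poisson_mean (z : C) (r : R) : Cmod z < r -> rmean (poisson z r) = 1.
Proof.
  intros Hz.
  assert (H : holo_on (fun _ => 1%C) (fun _ => 0%C) (r + 1)).
  { intros w _. split. apply has_cderiv_const. apply ccont_const. }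
  assert (E := poisson_formula _ _ _ r z H ltac:(lra) Hz). simpl in E.
  apply (f_equal Re) in E. rewrite re_RtoC in E. rewrite E. unfold cmean. simpl.
  apply rmean_ext. intros t. rewrite Rmult_0_l, Rmult_1_l. ring.
Qed.

(** Either v <= A, or v / A >= 1 and then v / A <= (v / A)^p. In [growth] this trades the first
    power under the Poisson integral for the p-th power, with a threshold [A] still to be chosen. *)
Lemma le_add_rpow (v A p : R) : 1 <= p -> 0 <= v -> 0 < A -> v <= A + rpow v p * (A / rpow A p).
Proof.
  intros Hp Hv HA. pose proof (rpow_pos A p HA) as HAp.
  assert (Hd : 0 < A / rpow A p) by (apply Rdiv_lt_0_compat; assumption).
  destruct (Rle_dec v A) as [H|H].
  - pose proof (rpow_nonneg v p). nra.
  - assert (HvA : v = A * (v / A)) by (field; lra).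
    assert (H1 : 1 <= v / A) by (apply (Rmult_le_reg_l A); [lra|]; rewrite <- HvA; lra).
    assert (H2 : v / A <= rpow (v / A) p).
    { rewrite rpow_eq by lra. rewrite <- (Rpower_1 (v / A)) at 1 by lra. apply Rle_Rpower; lra. }
    assert (H3 : rpow v p = rpow A p * rpow (v / A) p).
    { rewrite HvA at 1. apply rpow_mult; lra. }
    rewrite H3. replace (rpow A p * rpow (v / A) p * (A / rpow A p)) with (A * rpow (v / A) p) by (field; lra).
    nra.
Qed.

(** With y = 1 - |z| take the threshold A = K y^(-1/p), so that A^p = K^p / y. The part below the
    threshold contributes A, because the Poisson kernel has mean 1. The rest contributes at most (4
    / y) A^(1-p) K^p = 4 A. This is the origin of the constant 5. *)
Lemma growth (p : R) (g : C -> C) (K : R) (z : C) :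
  1 < p -> holo2 g -> 0 < K -> mean_bound p g (rpow K p) -> in_disk z ->
  Cmod (g z) <= 5 * K * Rpower (1 - Cmod z) (- / p).
Proof.
  intros Hp Hg HK Hb Hz. unfold in_disk in Hz. pose proof (Cmod_ge_0 z) as H0.
  set (y := 1 - Cmod z). assert (Hy : 0 < y) by (unfold y; lra).
  set (r := (1 + Cmod z) / 2). assert (Hr : Cmod z < r < 1) by (unfold r; lra).
  set (A := K * Rpower y (- / p)).
  assert (HA : 0 < A) by (apply Rmult_lt_0_compat; [lra|apply exp_pos]).
  assert (HAp : rpow A p = rpow K p / y).
  { unfold A. rewrite rpow_mult; [|lra|left; apply exp_pos].
    rewrite (rpow_eq (Rpower _ _)) by apply exp_pos. rewrite Rpower_mult.
    replace (- / p * p) with (- (1)) by (field; lra). rewrite Rpower_Ropp, Rpower_1 by exact Hy. reflexivity. }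
  pose proof (rpow_pos K p HK) as HKp.
  rewrite (poisson_formula g (cderiv g) 1 r z (holo2_holo_on g Hg)) by lra.
  assert (Hgc : ccurve (fun t => g (zeta r t))) by (apply analytic_circle; [apply Hg|lra]).
  assert (Hpc := rcont_poisson z r (proj1 Hr)).
  assert (Hmc := rcont_mean_p p g r ltac:(lra) (proj1 Hg) ltac:(lra)).
  set (q := 4 / y * (A / rpow A p)).
  assert (Hq : 0 <= q).
  { apply Rmult_le_pos; left; apply Rdiv_lt_0_compat; try lra. apply rpow_pos, HA. }
  apply Rle_trans with (rmean (fun t => A * poisson z r t + q * rpow (Cmod (g (zeta r t))) p)).
  - apply Cmod_cmean_le.
    + apply ccurve_mult. exact Hgc. split. exact Hpc. exact (rcont_const 0).
    + apply rcont_plus; apply rcont_mult; try apply rcont_const; assumption.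
    + intros t. rewrite Cmod_mult, Cmod_R.
      pose proof (poisson_pos z r t (proj1 Hr)) as Hpp. rewrite Rabs_pos_eq by lra.
      pose proof (poisson_le z r t (proj1 Hr)) as Hpl.
      (* The radius [r] is halfway between |z| and 1, so r - |z| = y / 2, while r + |z| <= 2. *)
      assert (Hpl' : poisson z r t <= 4 / y).
      { eapply Rle_trans. exact Hpl. replace (r - Cmod z) with (y / 2) by (unfold r, y; field).
        unfold Rdiv. rewrite Rinv_mult, Rinv_inv. apply (Rmult_le_reg_r y). exact Hy.
        replace ((r + Cmod z) * (/ y * 2) * y) with (2 * (r + Cmod z)) by (field; lra).
        replace (4 * / y * y) with 4 by (field; lra). lra. }
      pose proof (le_add_rpow (Cmod (g (zeta r t))) A p ltac:(lra) (Cmod_ge_0 _) HA) as HY.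
      apply Rle_trans with ((A + rpow (Cmod (g (zeta r t))) p * (A / rpow A p)) * poisson z r t).
      * apply Rmult_le_compat_r; lra.
      * rewrite Rmult_plus_distr_r. apply Rplus_le_compat_l.
        unfold q.
        assert (0 <= rpow (Cmod (g (zeta r t))) p * (A / rpow A p)).
        { apply Rmult_le_pos. apply rpow_nonneg. left. apply Rdiv_lt_0_compat. exact HA. apply rpow_pos, HA. }
        nra.
  - rewrite rmean_plus; try (apply rcont_mult; try apply rcont_const; assumption).
    rewrite !rmean_scal by assumption. rewrite poisson_mean by apply Hr.
    rewrite <- mean_p_rmean. pose proof (Hb r ltac:(lra)) as Hbr.
    apply Rle_trans with (A * 1 + q * rpow K p).
    + apply Rplus_le_compat_l, Rmult_le_compat_l; assumption.
    + right. unfold q. rewrite HAp. unfold A, Rdiv. field. lra.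
Qed.

(* The majorant of [growth] is integrable along a radius because [p > 1]; the mean value theorem compares [F] with its primitive. *)
Lemma point_evaluation (p : R) (F : C -> C) (K : R) (z : C) :
  1 < p -> holo2 F -> 0 < K -> mean_bound p (cderiv F) (rpow K p) -> in_disk z ->
  Cmod (F z - F 0%C) <= 5 * K / (1 - / p).
Proof.
  intros Hp HF HK Hb Hz. unfold in_disk in Hz. pose proof (Cmod_ge_0 z) as H0.
  set (q := 1 - / p).
  assert (Hq : 0 < q).
  { unfold q. assert (/ p < 1) by (rewrite <- Rinv_1; apply Rinv_lt_contravar; lra). lra. }
  assert (HC : 0 < 5 * K / q) by (apply Rdiv_lt_0_compat; lra).
  destruct (Ceq_dec (F z - F 0)%C 0) as [E|E].
  { rewrite E, Cmod_0. lra. }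
  pose proof (proj1 (Cmod_gt_0 _) E) as Hm.
  set (m := Cmod (F z - F 0%C)) in *.
  (* A unimodular factor turns the increment into the positive real [m], so that the real mean value
     theorem applies to a real part. *)
  set (c := (Cconj (F z - F 0) * / RtoC m)%C).
  assert (HmC : RtoC m <> 0) by (intros A; apply RtoC_inj in A; lra).
  assert (Hc : Cmod c = 1).
  { unfold c. rewrite Cmod_mult, Cmod_conj, Cmod_inv, Cmod_R, Rabs_pos_eq by (try exact HmC; lra).
    fold m. field. lra. }
  assert (Hcm : (c * (F z - F 0))%C = RtoC m).
  { unfold c. transitivity ((F z - F 0) * Cconj (F z - F 0) * / RtoC m)%C. ring.
    rewrite <- Cmod2_conj. fold m. rewrite RtoC_pow. field. exact HmC. }
  set (psi := fun s => Re (c * F (RtoC s * z))%C).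
  (* The exponent q = 1 - 1/p is positive, which keeps [Th] between -5 K / q and 0 all the way to
     the boundary; its total increase is the bound claimed. *)
  set (Th := fun s => - (5 * K / q) * exp (q * ln (1 - s * Cmod z))).
  set (dpsi := fun s => Re (c * (cderiv F (RtoC s * z) * z))%C).
  set (dTh := fun s => 5 * K * Cmod z * Rpower (1 - s * Cmod z) (- / p)).
  assert (Hs : forall s, 0 <= s <= 1 -> Cmod (RtoC s * z) = s * Cmod z).
  { intros s Hs. rewrite Cmod_mult, Cmod_R, Rabs_pos_eq by lra. reflexivity. }
  assert (Hder : forall s, 0 <= s <= 1 -> is_derive (fun s => psi s - Th s) s (dpsi s - dTh s)).
  { intros s Hs1. pose proof (Hs s Hs1) as Hs2.
    assert (Hpos : 0 < 1 - s * Cmod z) by nra.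
    apply (is_derive_minus (K := R_AbsRing) (V := R_NormedModule) psi Th).
    - assert (Hv : vderiv (fun s => RtoC s * z)%C s z).
      { unfold vderiv, Re, Im; simpl. split; auto_derive; trivial; ring. }
      apply (vderiv_scal c (fun s => F (RtoC s * z))%C).
      apply (vderiv_comp F (fun s => RtoC s * z)%C); [|exact Hv].
      apply cderiv_correct, HF. unfold in_disk. nra.
    - unfold Th, dTh, Rpower. auto_derive. lra.
      replace (- / p) with (q - 1) by (unfold q; ring).
      assert (E4 : exp ((q - 1) * ln (1 - s * Cmod z)) = exp (q * ln (1 - s * Cmod z)) * / (1 - s * Cmod z)).
      { replace ((q - 1) * ln (1 - s * Cmod z)) with (q * ln (1 - s * Cmod z) + - ln (1 - s * Cmod z)) by ring.
        rewrite exp_plus, exp_Ropp, exp_ln by exact Hpos. reflexivity. }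
      rewrite E4. unfold Rminus. field. split; lra. }
  destruct (MVT_gen (fun s => psi s - Th s) 0 1 (fun s => dpsi s - dTh s)) as [s [Hs1 HM]].
  - rewrite Rmin_left, Rmax_right by lra. intros s Hs1. apply Hder. lra.
  - rewrite Rmin_left, Rmax_right by lra. intros s Hs1. apply continuity_pt_filterlim.
    apply (ex_derive_continuous (K := R_AbsRing) (V := R_NormedModule) (fun s => psi s - Th s)).
    eexists. apply Hder, Hs1.
  - rewrite Rmin_left, Rmax_right in Hs1 by lra. pose proof (Hs s Hs1) as Hs2.
    assert (Hle : dpsi s <= dTh s).
    { unfold dpsi, dTh. eapply Rle_trans. apply Rle_abs. eapply Rle_trans. apply re_le_Cmod.
      rewrite !Cmod_mult, Hc, Rmult_1_l, <- Hs2.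
      replace (5 * K * Cmod z * Rpower (1 - Cmod (RtoC s * z)) (- / p)) with
        (5 * K * Rpower (1 - Cmod (RtoC s * z)) (- / p) * Cmod z) by ring.
      apply Rmult_le_compat_r. exact H0. apply (growth p); try assumption.
      apply holo2_cderiv, HF. unfold in_disk. nra. }
    assert (E1 : psi 1 - psi 0 = m).
    { unfold psi. replace (RtoC 1 * z)%C with z by ring. replace (RtoC 0 * z)%C with (RtoC 0) by ring.
      transitivity (Re (c * (F z - F 0))%C).
      - unfold Cminus. rewrite Cmult_plus_distr_l, re_plus.
        replace (c * - F 0)%C with (- (c * F 0))%C by ring. rewrite re_opp. reflexivity.
      - rewrite Hcm. apply re_RtoC. }
    assert (E2 : Th 1 <= 0).
    { unfold Th. pose proof (exp_pos (q * ln (1 - 1 * Cmod z))). nra. }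
    assert (E3 : Th 0 = - (5 * K / q)).
    { unfold Th. rewrite Rmult_0_l, Rminus_0_r, ln_1, Rmult_0_r, exp_0. ring. }
    rewrite <- E1. lra.
Qed.

(** * Test functions *)

Lemma in_Sp_holo2 (p : R) (f : C -> C) : in_Sp p f -> holo2 f.
Proof. intros [H1 [H2 _]]. split; assumption. Qed.

Lemma mean_bound_in_Hp (p : R) (g : C -> C) (B : R) :
  analytic_on_disk g -> mean_bound p g B -> in_Hp p g.
Proof.
  intros Hg Hb. split. exact Hg. apply Rbar_le_lt_trans with (Finite B); [|exact I].
  apply (proj2 (Lub_Rbar_correct (fun x => exists r, 0 < r < 1 /\ x = mean_p p g r))).
  intros x [r [Hr ->]]. apply Hb, Hr.
Qed.

Lemma rpow_Cmod_minus (p : R) (a b : C) : 0 < p ->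
  rpow (Cmod (a - b)) p <= rpow 2 p * (rpow (Cmod a) p + rpow (Cmod b) p).
Proof.
  intros Hp. pose proof (Cmod_ge_0 a). pose proof (Cmod_ge_0 b).
  pose proof (Cmod_minus_triangle a b) as H1.
  pose proof (rpow_nonneg (2 * Cmod a) p). pose proof (rpow_nonneg (2 * Cmod b) p).
  rewrite Rmult_plus_distr_l, <- !rpow_mult by lra.
  destruct (Rle_dec (Cmod a) (Cmod b)).
  - apply Rle_trans with (rpow (2 * Cmod b) p); [apply rpow_le|]; lra.
  - apply Rle_trans with (rpow (2 * Cmod a) p); [apply rpow_le|]; lra.
Qed.

(** An infinite supremum is sent to 0 by [real], so a small [Sp_norm] is informative only for a
    function already known to lie in S^p. In the necessity proof the differences must first be
    certified as members. *)
Lemma in_Sp_minus (p : R) (f g : C -> C) :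
  0 < p -> in_Sp p f -> in_Sp p g -> in_Sp p (fun z => f z - g z)%C.
Proof.
  intros Hp Hf Hg.
  pose proof (in_Sp_holo2 _ _ Hf) as H2f. pose proof (in_Sp_holo2 _ _ Hg) as H2g.
  destruct Hf as [Hf0 Hf]. destruct Hg as [Hg0 Hg].
  destruct (in_Hp_finite p _ Hp Hf) as [sf [_ [_ Hbf]]].
  destruct (in_Hp_finite p _ Hp Hg) as [sg [_ [_ Hbg]]].
  split. apply analytic_minus; assumption.
  apply mean_bound_in_Hp with (rpow 2 p * (sf + sg)).
  - apply holo2_minus; assumption.
  - intros r Hr. specialize (Hbf r Hr). specialize (Hbg r Hr).
    assert (Cf := rcont_mean_p p _ r Hp (proj1 Hf) ltac:(lra)).
    assert (Cg := rcont_mean_p p _ r Hp (proj1 Hg) ltac:(lra)).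
    rewrite mean_p_rmean in *.
    apply Rle_trans with (rmean (fun t => rpow 2 p * (rpow (Cmod (cderiv f (zeta r t))) p + rpow (Cmod (cderiv g (zeta r t))) p))).
    + apply rmean_le.
      * apply rcont_mean_p; try lra. apply holo2_minus; assumption.
      * apply rcont_mult. apply rcont_const. apply rcont_plus; assumption.
      * intros t. rewrite cderiv_minus; try assumption. apply rpow_Cmod_minus, Hp.
        unfold in_disk. rewrite Cmod_zeta; lra.
    + rewrite rmean_scal by (apply rcont_plus; assumption).
      rewrite rmean_plus by assumption.
      apply Rmult_le_compat_l. apply rpow_nonneg. lra.
Qed.

(** The right-hand side does not depend on [z]: S^p functions are bounded on the disk, and
    evaluation points may vary with the function. The [+ 1] supplies the strictly positive constant
    that [point_evaluation] asks for. *)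
Lemma in_Sp_bound (p : R) (f : C -> C) (z : C) :
  1 < p -> in_Sp p f -> in_disk z ->
  Cmod (f z) <= Cmod (f 0%C) + 5 * (Sp_norm p f + 1) / (1 - / p).
Proof.
  intros Hp Hf Hz. pose proof (Hp_norm_nonneg p (cderiv f)) as Hn.
  pose proof (Cmod_ge_0 (f 0%C)) as H0.
  assert (HM : Hp_norm p (cderiv f) <= Sp_norm p f + 1) by (unfold Sp_norm; lra).
  assert (HS : 0 <= Sp_norm p f) by (unfold Sp_norm; lra).
  assert (H := point_evaluation p f (Sp_norm p f + 1) z Hp (in_Sp_holo2 _ _ Hf) ltac:(lra)
     (in_Hp_mean_bound p _ _ ltac:(lra) (proj2 Hf) HM) Hz).
  pose proof (Cmod_triangle_inv (f z) (f 0%C)). lra.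
Qed.

(* Since [p > 1], the square of the Cauchy kernel serves for all exponents: its [p]-th power is dominated by the Poisson kernel. *)
Definition test_fun (p : R) (a : C) : C -> C :=
  fun w => (RtoC (Rpower (1 - Cmod a) (2 - / p)) * (w * / (1 - Cconj a * w)))%C.

Lemma test_fun_neq (a w : C) : in_disk a -> in_disk w -> (1 - Cconj a * w)%C <> 0.
Proof.
  intros Ha Hw. unfold in_disk in *. apply one_minus_neq. rewrite Cmod_mult, Cmod_conj.
  pose proof (Cmod_ge_0 a). pose proof (Cmod_ge_0 w). nra.
Qed.

(** The quotient w / (1 - conj(a) w) is the primitive of the squared kernel that vanishes at 0, so
    the value at 0 adds nothing to [Sp_norm]. *)
Lemma test_fun_deriv (p : R) (a w : C) : in_disk a -> in_disk w ->
  has_cderiv (test_fun p a) w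
    (RtoC (Rpower (1 - Cmod a) (2 - / p)) * (/ (1 - Cconj a * w) * / (1 - Cconj a * w)))%C.
Proof.
  intros Ha Hw. pose proof (test_fun_neq a w Ha Hw) as Hn.
  set (c := RtoC (Rpower (1 - Cmod a) (2 - / p))).
  set (q := (/ (1 - Cconj a * w))%C).
  assert (E : (1 * q + w * (Cconj a * (q * q)))%C = (q * q)%C).
  { unfold q. field. exact Hn. }
  rewrite <- E, Cmult_comm.
  apply (has_cderiv_comp (fun v => c * v)%C (fun w => w * / (1 - Cconj a * w))%C).
  - apply has_cderiv_scal.
  - apply has_cderiv_mult. apply has_cderiv_id. apply cderiv_geom, Hn.
Qed.

Lemma test_fun_holo2 (p : R) (a : C) : in_disk a -> holo2 (test_fun p a).
Proof.
  intros Ha. split.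
  - intros w Hw. eexists. apply test_fun_deriv; assumption.
  - apply (analytic_ext (fun w => RtoC (Rpower (1 - Cmod a) (2 - / p)) *
       (/ (1 - Cconj a * w) * / (1 - Cconj a * w)))%C).
    + intros w Hw. symmetry. apply cderiv_unique, test_fun_deriv; assumption.
    + intros w Hw. eexists. apply has_cderiv_mult. apply has_cderiv_const.
      apply has_cderiv_mult; apply cderiv_geom, test_fun_neq; assumption.
Qed.

(** On the circle |zeta| = r one has r^2 = zeta conj(zeta), hence |zeta - r^2 a| = r |1 - conj(a)
    zeta|. The squared kernel is thus a multiple of the Poisson kernel at r^2 a, whose mean is
    known. *)
Lemma geom_poisson (a : C) (r t : R) : in_disk a -> 0 < r < 1 ->
  Cmod (/ (1 - Cconj a * zeta r t)) ^ 2 * (1 - r * r * (Cmod a * Cmod a)) = poisson (RtoC (r * r) * a) r t.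
Proof.
  intros Ha Hr. unfold in_disk in Ha. pose proof (Cmod_ge_0 a) as H0.
  assert (Hn : (1 - Cconj a * zeta r t)%C <> 0).
  { apply test_fun_neq. exact Ha. unfold in_disk. rewrite Cmod_zeta; lra. }
  assert (Hn2 : Cmod (zeta r t - RtoC (r * r) * a) = r * Cmod (1 - Cconj a * zeta r t)).
  { rewrite <- (zeta_conj r t).
    replace (zeta r t - zeta r t * Cconj (zeta r t) * a)%C with
      (zeta r t * Cconj (1 - Cconj a * zeta r t))%C.
    - rewrite Cmod_mult, Cmod_conj, Cmod_zeta by lra. reflexivity.
    - rewrite Cminus_conj, Cmult_conj, Cconj_conj.
      replace (Cconj 1) with (RtoC 1) by (unfold Cconj, RtoC; simpl; f_equal; ring). ring. }
  pose proof (proj1 (Cmod_gt_0 _) Hn) as Hp.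
  unfold poisson. rewrite Hn2, Cmod_mult, Cmod_R, Rabs_pos_eq by nra.
  rewrite Cmod_inv by exact Hn. field. split; lra.
Qed.

(** Let y = 1 - |a| and let v be the squared modulus of the Cauchy kernel, so v <= y^(-2). The
    integrand is y^(2p-1) v^p, and v^(p-1) <= y^(2-2p) leaves at most y v. As y <= 1 - r^2 |a|^2,
    this is below the Poisson kernel. The exponent 2 - 1/p in [test_fun] is what makes the powers of
    y balance. *)
Lemma test_fun_mean (p : R) (a : C) : 1 < p -> in_disk a -> mean_bound p (cderiv (test_fun p a)) 1.
Proof.
  intros Hp Ha r Hr. pose proof (test_fun_holo2 p a Ha) as HF.
  unfold in_disk in Ha. pose proof (Cmod_ge_0 a) as H0.
  set (y := 1 - Cmod a). assert (Hy : 0 < y) by (unfold y; lra).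
  assert (Hz : Cmod (RtoC (r * r) * a) < r).
  { rewrite Cmod_mult, Cmod_R, Rabs_pos_eq by nra.
    apply Rle_lt_trans with (r * r * 1); [apply Rmult_le_compat_l|]; nra. }
  rewrite mean_p_rmean, <- (poisson_mean _ r Hz).
  apply rmean_le.
  - apply rcont_mean_p; try lra. apply HF.
  - apply rcont_poisson, Hz.
  - intros t.
    assert (Hd : in_disk (zeta r t)) by (unfold in_disk; rewrite Cmod_zeta; lra).
    rewrite (cderiv_unique _ _ _ (test_fun_deriv p a _ Ha Hd)).
    rewrite <- (geom_poisson a r t Ha Hr).
    pose proof (test_fun_neq a _ Ha Hd) as Hn.
    set (q := (/ (1 - Cconj a * zeta r t))%C).
    assert (Hq : 0 < Cmod q).
    { unfold q. rewrite Cmod_inv by exact Hn. apply Rinv_0_lt_compat, Cmod_gt_0, Hn. }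
    assert (Hqy : Cmod q <= / y).
    { unfold q. rewrite Cmod_inv by exact Hn. apply Rinv_le_contravar. exact Hy.
      pose proof (Cmod_triangle_inv 1 (Cconj a * zeta r t)) as H.
      rewrite Cmod_1, Cmod_mult, Cmod_conj, Cmod_zeta in H by lra. unfold y. nra. }
    rewrite !Cmod_mult, Cmod_R. fold y. fold q.
    rewrite Rabs_pos_eq by (left; apply exp_pos).
    set (v := Cmod q * Cmod q). replace (Cmod q ^ 2) with v by (unfold v; ring).
    assert (Hv : 0 < v) by (unfold v; nra).
    assert (Hiy : 0 < / y) by (apply Rinv_0_lt_compat, Hy).
    assert (Hvy : v <= Rpower y (- (2))).
    { rewrite Rpower_Ropp. replace 2 with (INR 2) by (simpl; ring). rewrite Rpower_pow by exact Hy.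
      simpl. rewrite Rmult_1_r, Rinv_mult. unfold v. nra. }
    rewrite rpow_mult by (try lra; left; apply exp_pos).
    rewrite (rpow_eq (Rpower _ _)) by apply exp_pos. rewrite (rpow_eq v) by exact Hv.
    rewrite Rpower_mult.
    assert (E1 : Rpower v p = v * Rpower v (p - 1)).
    { rewrite <- (Rpower_1 v) at 2 by exact Hv. rewrite <- Rpower_plus. f_equal. ring. }
    assert (E2 : Rpower v (p - 1) <= Rpower y (2 - 2 * p)).
    { replace (2 - 2 * p) with (- (2) * (p - 1)) by ring. rewrite <- Rpower_mult.
      apply Rle_Rpower_l. lra. split; assumption. }
    assert (E3 : Rpower y ((2 - / p) * p) * Rpower y (2 - 2 * p) = y).
    { rewrite <- Rpower_plus. replace ((2 - / p) * p + (2 - 2 * p)) with 1 by (field; lra).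
      apply Rpower_1, Hy. }
    rewrite E1.
    apply Rle_trans with (v * y).
    + replace (v * y) with (v * (Rpower y ((2 - / p) * p) * Rpower y (2 - 2 * p))) by (rewrite E3; reflexivity).
      pose proof (exp_pos (((2 - / p) * p) * ln y)) as Hpos.
      fold (Rpower y ((2 - / p) * p)) in Hpos.
      replace (Rpower y ((2 - / p) * p) * (v * Rpower v (p - 1))) with
        (v * Rpower y ((2 - / p) * p) * Rpower v (p - 1)) by ring.
      rewrite <- Rmult_assoc. apply Rmult_le_compat_l; [nra|exact E2].
    + apply Rmult_le_compat_l. lra. unfold y.
      assert (r * r * (Cmod a * Cmod a) <= 1 * Cmod a) by (apply Rmult_le_compat; nra). lra.
Qed.

Lemma test_fun_Sp (p : R) (a : C) : 1 < p -> in_disk a ->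
  in_Sp p (test_fun p a) /\ Sp_norm p (test_fun p a) <= 1.
Proof.
  intros Hp Ha. pose proof (test_fun_holo2 p a Ha) as HF.
  assert (Hm := test_fun_mean p a Hp Ha). rewrite <- (rpow_base_1 p) in Hm.
  destruct (mean_bound_Hp p _ 1 ltac:(lra) ltac:(lra) (proj2 HF) Hm) as [H1 H2].
  split. split; [apply HF|exact H1].
  unfold Sp_norm. replace (test_fun p a 0%C) with (RtoC 0) by (unfold test_fun; ring).
  rewrite Cmod_0. lra.
Qed.

(** At w = a the kernel is 1 / (1 - |a|^2) >= 1 / (2 y) with y = 1 - |a|. Squaring produces the 4,
    and the normalization y^(2 - 1/p) leaves y^(-1/p). *)
Lemma test_fun_value (p : R) (a : C) : 1 < p -> in_disk a ->
  Rpower (1 - Cmod a) (- / p) / 4 <= Cmod (cderiv (test_fun p a) a).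
Proof.
  intros Hp Ha. pose proof (test_fun_neq a a Ha Ha) as Hn.
  rewrite (cderiv_unique _ _ _ (test_fun_deriv p a a Ha Ha)).
  unfold in_disk in Ha. pose proof (Cmod_ge_0 a) as H0.
  set (y := 1 - Cmod a). assert (Hy : 0 < y) by (unfold y; lra).
  assert (E : (1 - Cconj a * a)%C = RtoC (1 - Cmod a ^ 2)).
  { rewrite RtoC_minus, Cmod2_conj. ring. }
  rewrite E. assert (Hq : 0 < 1 - Cmod a ^ 2) by nra.
  rewrite <- RtoC_inv by lra. rewrite !Cmod_mult, !Cmod_R.
  rewrite !Rabs_pos_eq; [|left; apply Rinv_0_lt_compat; lra|left; apply exp_pos].
  assert (E5 : Rpower y (2 - / p) = y ^ 2 * Rpower y (- / p)).
  { unfold Rminus. rewrite Rpower_plus. f_equal.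
    replace 2 with (INR 2) at 1 by (simpl; ring). apply Rpower_pow, Hy. }
  fold y. rewrite E5.
  pose proof (exp_pos (- / p * ln y)) as Hpos. fold (Rpower y (- / p)) in Hpos.
  assert (Hle : / (2 * y) <= / (1 - Cmod a ^ 2)).
  { apply Rinv_le_contravar. exact Hq. unfold y. nra. }
  assert (Hiy : 0 < / (2 * y)) by (apply Rinv_0_lt_compat; lra).
  apply Rle_trans with (y ^ 2 * Rpower y (- / p) * (/ (2 * y) * / (2 * y))).
  - right. field. lra.
  - apply Rmult_le_compat_l. apply Rmult_le_pos; nra. nra.
Qed.

(** * Necessity: compactness keeps the image of phi away from the circle *)

Lemma sup_norm_approx (phi : C -> C) :
  ~ Rbar_lt (sup_norm phi) 1 -> forall e, 0 < e -> exists z, in_disk z /\ 1 - e < Cmod (phi z).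
Proof.
  intros H e He. apply NNPP. intros Hn. apply H.
  apply Rbar_le_lt_trans with (Finite (1 - e)); [|simpl; lra].
  apply (proj2 (Lub_Rbar_correct (fun x => exists z, in_disk z /\ x = Cmod (phi z)))).
  intros x [z [Hz ->]]. simpl. apply Rnot_lt_le. intros Hl. apply Hn. exists z. auto.
Qed.

Lemma strict_incr_ge (sub : nat -> nat) :
  (forall k, (sub k < sub (S k))%nat) -> forall k, (k <= sub k)%nat.
Proof. intros H k. induction k as [|k IH]. lia. specialize (H k). lia. Qed.

Lemma compact_sup_norm (p : R) (phi : C -> C) :
  1 < p -> self_map phi -> compact_D_Sp p phi -> Rbar_lt (sup_norm phi) 1.
Proof.
  intros Hp [Hphi Hself] [HD Hc]. apply NNPP. intros Hn.
  assert (Hex : forall n, exists z, in_disk z /\ 1 - / (INR n + 1) < Cmod (phi z)).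
  { intros n. apply sup_norm_approx. exact Hn. apply Rinv_0_lt_compat. pose proof (pos_INR n). lra. }
  set (zs := fun n => proj1_sig (constructive_indefinite_description _ (Hex n))).
  assert (Hzs : forall n, in_disk (zs n) /\ 1 - / (INR n + 1) < Cmod (phi (zs n))).
  { intros n. exact (proj2_sig (constructive_indefinite_description _ (Hex n))). }
  set (a := fun n => phi (zs n)).
  assert (Ha : forall n, in_disk (a n)) by (intros n; apply Hself, Hzs).
  destruct (Hc (fun n => test_fun p (a n)) 1) as [sub [g [Hsub [Hg Hlim]]]].
  { intros n. apply test_fun_Sp. exact Hp. apply Ha. }
  set (Fk := fun k z => (D_op phi (test_fun p (a (sub k))) z - g z)%C).
  assert (HFk : forall k, in_Sp p (Fk k)).
  { intros k. apply (in_Sp_minus p (D_op phi (test_fun p (a (sub k)))) g). lra.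
    apply HD. apply test_fun_Sp. exact Hp. apply Ha. exact Hg. }
  set (q := 1 - / p).
  assert (Hq : 0 < q).
  { unfold q. assert (/ p < 1) by (rewrite <- Rinv_1; apply Rinv_lt_contravar; lra). lra. }
  (* The first summand bounds a difference [Fk k] of S^p norm at most 1 anywhere in the disk, the
     second bounds [g]; neither depends on [k]. *)
  set (B := (1 + 5 * (1 + 1) / q) + (Cmod (g 0%C) + 5 * (Sp_norm p g + 1) / q)).
  assert (HB : exists N, forall k, (N <= k)%nat ->
     Cmod (cderiv (test_fun p (a (sub k))) (a (sub k))) <= B).
  { apply is_lim_seq_spec in Hlim. destruct (Hlim (mkposreal 1 Rlt_0_1)) as [N HN].
    exists N. intros k Hk. specialize (HN k Hk). simpl in HN. fold (Fk k) in HN.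
    rewrite Rminus_0_r in HN.
    assert (HNk : Sp_norm p (Fk k) <= 1).
    { eapply Rle_trans; [apply Rle_abs|]. left. exact HN. }
    pose proof (in_Sp_bound p (Fk k) (zs (sub k)) Hp (HFk k) (proj1 (Hzs (sub k)))) as H1.
    pose proof (in_Sp_bound p g (zs (sub k)) Hp Hg (proj1 (Hzs (sub k)))) as H2.
    fold q in H1, H2.
    pose proof (Hp_norm_nonneg p (cderiv (Fk k))) as H3.
    assert (H4 : Cmod (Fk k 0%C) <= 1) by (unfold Sp_norm in HNk; lra).
    replace (cderiv (test_fun p (a (sub k))) (a (sub k))) with (Fk k (zs (sub k)) + g (zs (sub k)))%C
      by (unfold Fk, D_op, a; ring).
    eapply Rle_trans. apply Cmod_triangle. unfold B. apply Rplus_le_compat.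
    - eapply Rle_trans. exact H1. apply Rplus_le_compat. exact H4.
      unfold Rdiv. apply Rmult_le_compat_r. left. apply Rinv_0_lt_compat, Hq. lra.
    - exact H2. }
  destruct HB as [N HN].
  assert (HB0 : 0 <= B).
  { eapply Rle_trans; [|apply (HN N); lia]. apply Cmod_ge_0. }
  (* If 1 - |a| < T then (1 - |a|)^(-1/p) > 4 B + 1, which contradicts the bound [B] through the
     factor 4 in [test_fun_value]. *)
  set (T := Rpower (4 * B + 1) (- p)).
  assert (HT : 0 < T) by apply exp_pos.
  destruct (archimed_cor1 T HT) as [n [Hn1 Hn2]].
  (* Past [N] the bound [B] holds; past [n], since [sub k >= k], the point [a (sub k)] is within [T]
     of the circle. *)
  set (k := (N + n)%nat). specialize (HN k ltac:(unfold k; lia)).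
  pose proof (test_fun_value p _ Hp (Ha (sub k))) as Hv.
  destruct (Hzs (sub k)) as [_ Hz2]. fold (a (sub k)) in Hz2.
  pose proof (Ha (sub k)) as Hak. unfold in_disk in Hak.
  set (y := 1 - Cmod (a (sub k))) in *.
  assert (Hy : 0 < y < T).
  { split. unfold y; lra. apply Rlt_trans with (/ (INR (sub k) + 1)). unfold y; lra.
    eapply Rle_lt_trans; [|exact Hn1]. apply Rinv_le_contravar. apply lt_0_INR. lia.
    pose proof (strict_incr_ge sub Hsub k). apply Rle_trans with (INR (sub k)).
    apply le_INR. unfold k in *. lia. lra. }
  assert (Hip : 0 < / p) by (apply Rinv_0_lt_compat; lra).
  assert (H5 : Rpower y (/ p) < / (4 * B + 1)).
  { replace (/ (4 * B + 1)) with (Rpower T (/ p)).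
    - apply Rlt_Rpower_l; lra.
    - unfold T. rewrite Rpower_mult. replace (- p * / p) with (- (1)) by (field; lra).
      rewrite Rpower_Ropp, Rpower_1; lra. }
  assert (H6 : 4 * B + 1 < Rpower y (- / p)).
  { rewrite Rpower_Ropp. rewrite <- (Rinv_inv (4 * B + 1)). apply Rinv_lt_contravar; [|exact H5].
    apply Rmult_lt_0_compat. apply exp_pos. apply Rinv_0_lt_compat. lra. }
  lra.
Qed.

(** * Montel's theorem *)

Definition Clim (u : nat -> C) (l : C) : Prop :=
  forall eps, 0 < eps -> exists N, forall n, (N <= n)%nat -> Cmod (u n - l) < eps.

Definition incr (s : nat -> nat) : Prop := forall k, (s k < s (S k))%nat.

Lemma incr_lt (s : nat -> nat) : incr s -> forall i j, (i < j)%nat -> (s i < s j)%nat.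
Proof.
  intros H i j Hij. induction Hij as [|j Hij IH]. apply H. specialize (H j). lia.
Qed.

Lemma incr_comp (s t : nat -> nat) : incr s -> incr t -> incr (fun n => s (t n)).
Proof. intros Hs Ht k. apply incr_lt; [exact Hs|apply Ht]. Qed.

Lemma bounded_subseq_R (u : nat -> R) (B : R) :
  (forall n, Rabs (u n) <= B) ->
  exists s, incr s /\ exists l, forall eps, 0 < eps -> exists N, forall n, (N <= n)%nat -> Rabs (u (s n) - l) < eps.
Proof.
  intros HB.
  destruct (Bolzano_Weierstrass u (fun c => - B <= c <= B)) as [l Hl].
  { apply compact_P3. }
  { intros n. specialize (HB n). apply Rabs_le_between in HB. exact HB. }
  assert (Hp : forall N k, exists n, (N <= n)%nat /\ Rabs (u n - l) < / (INR k + 1)).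
  { intros N k. assert (Hk : 0 < / (INR k + 1)) by (apply Rinv_0_lt_compat; pose proof (pos_INR k); lra).
    destruct (Hl (disc l (mkposreal _ Hk)) N) as [n [Hn1 Hn2]].
    - exists (mkposreal _ Hk). intros x Hx. exact Hx.
    - exists n. split. exact Hn1. exact Hn2. }
  set (pick := fun N k => proj1_sig (constructive_indefinite_description _ (Hp N k))).
  assert (Hpick : forall N k, (N <= pick N k)%nat /\ Rabs (u (pick N k) - l) < / (INR k + 1)).
  { intros N k. exact (proj2_sig (constructive_indefinite_description _ (Hp N k))). }
  (* Bolzano-Weierstrass yields only a cluster value. An increasing sequence is extracted by picking
     each index beyond the previous one, within 1 / (k + 1) of [l]. *)
  set (s := fix s k := match k with O => pick O O | S k' => pick (S (s k')) k end).
  exists s. split.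
  - intros k. apply (proj1 (Hpick (S (s k)) (S k))).
  - exists l. intros eps He. destruct (archimed_cor1 eps He) as [N [HN1 HN2]].
    exists N. intros n Hn. apply Rlt_trans with (/ (INR n + 1)).
    + destruct n as [|n]; apply Hpick.
    + eapply Rle_lt_trans; [|exact HN1]. apply Rinv_le_contravar. apply lt_0_INR, HN2.
      apply le_INR in Hn. lra.
Qed.

Lemma bounded_subseq (u : nat -> C) (B : R) :
  (forall n, Cmod (u n) <= B) -> exists s, incr s /\ exists l, Clim (fun n => u (s n)) l.
Proof.
  intros HB.
  destruct (bounded_subseq_R (fun n => Re (u n)) B) as [s [Hs [a Ha]]].
  { intros n. eapply Rle_trans; [apply re_le_Cmod|apply HB]. }
  destruct (bounded_subseq_R (fun n => Im (u (s n))) B) as [t [Ht [b Hb]]].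
  { intros n. eapply Rle_trans; [apply Im_le_Cmod|apply HB]. }
  exists (fun n => s (t n)). split. apply incr_comp; assumption.
  exists (a, b). intros eps He.
  destruct (Ha (eps / 2)) as [N1 H1]. lra. destruct (Hb (eps / 2)) as [N2 H2]. lra.
  exists (max N1 N2). intros n Hn.
  pose proof (strict_incr_ge t Ht n).
  specialize (H1 (t n) ltac:(lia)). specialize (H2 n ltac:(lia)).
  eapply Rle_lt_trans. apply Cmod_le_Re_Im.
  change (Rabs (Re (u (s (t n))) - a) + Rabs (Im (u (s (t n))) - b) < eps). lra.
Qed.

Lemma diagonal_subseq (u : nat -> nat -> C) (B : nat -> R) :
  (forall k n, Cmod (u k n) <= B k) ->
  exists s, incr s /\ forall k, exists l, Clim (fun n => u k (s n)) l.
Proof.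
  intros HB.
  assert (Hex : forall k s, exists t, incr t /\ exists l, Clim (fun n => u k (s (t n))) l).
  { intros k s. apply (bounded_subseq (fun n => u k (s n)) (B k)). intros n. apply HB. }
  set (pick := fun k s => proj1_sig (constructive_indefinite_description _ (Hex k s))).
  assert (Hpick : forall k s, incr (pick k s) /\ exists l, Clim (fun n => u k (s (pick k s n))) l).
  { intros k s. exact (proj2_sig (constructive_indefinite_description _ (Hex k s))). }
  (* [sg k] has been refined for the sequences with index below [k], so the sequence [u k] converges
     along [sg (S k)]. *)
  set (sg := fix sg k := match k with O => fun n : nat => n | S k' => fun n => sg k' (pick k' (sg k') n) end).
  assert (Hsg : forall k, incr (sg k)).
  { induction k as [|k IH]. intros n. simpl. lia.
    apply (incr_comp (sg k) (pick k (sg k))). exact IH. apply Hpick. }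
  assert (Hsub : forall k m j, exists i, (j <= i)%nat /\ sg (m + k)%nat j = sg k i).
  { intros k m. induction m as [|m IH]; intros j.
    - exists j. split. lia. reflexivity.
    - destruct (IH (pick (m + k)%nat (sg (m + k)%nat) j)) as [i [Hi1 Hi2]].
      exists i. split; [|exact Hi2].
      pose proof (strict_incr_ge _ (proj1 (Hpick (m + k)%nat (sg (m + k)%nat))) j). lia. }
  exists (fun n => sg n n). split.
  - intros k. simpl. apply incr_lt; [apply Hsg|].
    pose proof (strict_incr_ge _ (proj1 (Hpick k (sg k))) (S k)). lia.
  - intros k. destruct (proj2 (Hpick k (sg k))) as [l Hl]. exists l.
    (* From index [S k] on, the n-th diagonal term is a term of [sg (S k)] of rank at least [n];
       hence the maximum with [S k]. *)
    intros eps He. destruct (Hl eps He) as [N HN]. exists (max N (S k)). intros n Hn.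
    destruct (Hsub (S k) (n - S k)%nat n) as [i [Hi1 Hi2]].
    replace (n - S k + S k)%nat with n in Hi2 by lia. rewrite Hi2.
    apply (HN i). lia.
Qed.

Lemma Clim_bound (u : nat -> C) (l : C) (B : R) :
  Clim u l -> (forall n, Cmod (u n) <= B) -> Cmod l <= B.
Proof.
  intros Hl HB. apply le_epsilon. intros eps He. destruct (Hl eps He) as [N HN].
  specialize (HN N (le_n N)). specialize (HB N).
  pose proof (Cmod_triangle_inv l (u N)). rewrite Cmod_minus_sym in H. lra.
Qed.

Lemma Clim_minus (u v : nat -> C) (a b : C) :
  Clim u a -> Clim v b -> Clim (fun n => u n - v n)%C (a - b).
Proof.
  intros Hu Hv eps He. destruct (Hu (eps / 2)) as [N1 H1]. lra. destruct (Hv (eps / 2)) as [N2 H2]. lra.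
  exists (max N1 N2). intros n Hn. specialize (H1 n ltac:(lia)). specialize (H2 n ltac:(lia)).
  replace (u n - v n - (a - b))%C with ((u n - a) - (v n - b))%C by ring.
  eapply Rle_lt_trans. apply Cmod_minus_triangle. lra.
Qed.

Lemma Clim_mult_const (u : nat -> C) (a c : C) : Clim u a -> Clim (fun n => u n * c)%C (a * c).
Proof.
  intros Hu eps He. pose proof (Cmod_ge_0 c) as Hc.
  destruct (Hu (eps / (Cmod c + 1))) as [N HN]. apply Rdiv_lt_0_compat; lra.
  exists N. intros n Hn. specialize (HN n Hn).
  replace (u n * c - a * c)%C with ((u n - a) * c)%C by ring. rewrite Cmod_mult.
  pose proof (Cmod_ge_0 (u n - a)) as H0.
  apply Rle_lt_trans with (Cmod (u n - a) * (Cmod c + 1)). nra.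
  apply (Rmult_lt_compat_r (Cmod c + 1)) in HN; [|lra].
  replace (eps / (Cmod c + 1) * (Cmod c + 1)) with eps in HN by (field; lra). exact HN.
Qed.

(** * Locally uniform limits of analytic functions *)

Definition ucauchy (r : R) (v : nat -> C -> C) : Prop :=
  forall s eps, s < r -> 0 < eps -> exists N, forall n m z,
    (N <= n)%nat -> (N <= m)%nat -> Cmod z <= s -> Cmod (v n z - v m z) <= eps.

Definition lbounded (r : R) (v : nat -> C -> C) : Prop :=
  forall s, s < r -> exists M, forall n z, Cmod z <= s -> Cmod (v n z) <= M.

(** A total function built from [Lim_seq]; its values are meaningful only where the sequence
    converges. *)
Definition limf (v : nat -> C -> C) (z : C) : C :=
  (real (Lim_seq (fun n => Re (v n z))), real (Lim_seq (fun n => Im (v n z)))).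

Lemma limf_correct (r : R) (v : nat -> C -> C) (z : C) :
  ucauchy r v -> Cmod z < r -> Clim (fun n => v n z) (limf v z).
Proof.
  intros Hv Hz.
  assert (HC : forall eps : posreal, exists N, forall n m, (N <= n)%nat -> (N <= m)%nat ->
     Cmod (v n z - v m z) < eps).
  { intros eps. destruct (Hv (Cmod z) (eps / 2) Hz) as [N HN].
    pose proof (cond_pos eps). lra. exists N. intros n m Hn Hm.
    specialize (HN n m z Hn Hm (Rle_refl _)). pose proof (cond_pos eps). lra. }
  assert (H1 : ex_finite_lim_seq (fun n => Re (v n z))).
  { apply ex_lim_seq_cauchy_corr. intros eps. destruct (HC eps) as [N HN]. exists N. intros n m Hn Hm.
    eapply Rle_lt_trans; [|exact (HN n m Hn Hm)]. exact (re_le_Cmod (v n z - v m z)). }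
  assert (H2 : ex_finite_lim_seq (fun n => Im (v n z))).
  { apply ex_lim_seq_cauchy_corr. intros eps. destruct (HC eps) as [N HN]. exists N. intros n m Hn Hm.
    eapply Rle_lt_trans; [|exact (HN n m Hn Hm)]. exact (Im_le_Cmod (v n z - v m z)). }
  apply Lim_seq_correct' in H1. apply Lim_seq_correct' in H2.
  apply is_lim_seq_spec in H1. apply is_lim_seq_spec in H2.
  intros eps He. assert (He2 : 0 < eps / 2) by lra.
  destruct (H1 (mkposreal _ He2)) as [N1 A1]. destruct (H2 (mkposreal _ He2)) as [N2 A2].
  exists (max N1 N2). intros n Hn. specialize (A1 n ltac:(lia)). specialize (A2 n ltac:(lia)).
  simpl in A1, A2. eapply Rle_lt_trans. apply Cmod_le_Re_Im.
  change (Rabs (Re (v n z) - Lim_seq (fun n => Re (v n z))) + Rabs (Im (v n z) - Lim_seq (fun n => Im (v n z))) < eps).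
  lra.
Qed.

Lemma limf_uniform (r : R) (v : nat -> C -> C) (s eps : R) :
  ucauchy r v -> s < r -> 0 < eps -> exists N, forall n z,
    (N <= n)%nat -> Cmod z <= s -> Cmod (v n z - limf v z) <= eps.
Proof.
  intros Hv Hs He. destruct (Hv s (eps / 2) Hs) as [N HN]. lra.
  exists N. intros n z Hn Hz.
  destruct (limf_correct r v z Hv ltac:(lra) (eps / 2)) as [N2 HN2]. lra.
  specialize (HN2 (max N N2) ltac:(lia)).
  specialize (HN n (max N N2) z Hn ltac:(lia) Hz).
  replace (v n z - limf v z)%C with ((v n z - v (max N N2) z) + (v (max N N2) z - limf v z))%C by ring.
  eapply Rle_trans. apply Cmod_triangle. lra.
Qed.

Lemma lbounded_cderiv (r : R) (v : nat -> C -> C) :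
  0 < r <= 1 -> (forall n, holo2 (v n)) -> lbounded r v -> lbounded r (fun n => cderiv (v n)).
Proof.
  (* The radius [s] may be negative; [Rmax s 0] replaces it before an intermediate radius for the
     Cauchy estimate is chosen. *)
  intros Hr Hh Hv s Hs. pose proof (Rmax_l s 0) as H1. pose proof (Rmax_r s 0) as H2.
  assert (H3 : Rmax s 0 < r) by (apply Rmax_lub_lt; lra).
  set (r' := (Rmax s 0 + r) / 2). assert (Hr' : Rmax s 0 < r' < r) by (unfold r'; lra).
  destruct (Hv r') as [M HM]. lra. eexists. intros n z Hz.
  apply (cderiv_bound (v n) r' (Rmax s 0) M z (Hh n)); try lra.
  intros t. apply HM. rewrite Cmod_zeta; lra.
Qed.

Lemma ucauchy_cderiv (r : R) (v : nat -> C -> C) :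
  0 < r <= 1 -> (forall n, holo2 (v n)) -> ucauchy r v -> ucauchy r (fun n => cderiv (v n)).
Proof.
  intros Hr Hh Hv s eps Hs He. pose proof (Rmax_l s 0) as H1. pose proof (Rmax_r s 0) as H2.
  assert (H3 : Rmax s 0 < r) by (apply Rmax_lub_lt; lra).
  set (r' := (Rmax s 0 + r) / 2). assert (Hr' : Rmax s 0 < r' < r) by (unfold r'; lra).
  set (Q := r' * (/ (r' - Rmax s 0)) ^ 2).
  assert (HQ : 0 < Q).
  { apply Rmult_lt_0_compat. lra. apply pow_lt, Rinv_0_lt_compat. lra. }
  destruct (Hv r' (eps / Q)) as [N HN]. lra. apply Rdiv_lt_0_compat; lra.
  exists N. intros n m z Hn Hm Hz.
  rewrite <- cderiv_minus; [|exact (proj1 (Hh n))|exact (proj1 (Hh m))|unfold in_disk; lra].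
  replace eps with (eps / Q * Q) by (field; lra).
  apply (cderiv_bound (fun w => v n w - v m w)%C r' (Rmax s 0)); try lra.
  apply holo2_minus; apply Hh.
  intros t. apply HN; try assumption. rewrite Cmod_zeta; lra.
Qed.

(* The second-order Taylor estimate is uniform in [n], so it survives the limit. *)
Lemma limf_cderiv (r : R) (v : nat -> C -> C) (z : C) :
  0 < r <= 1 -> (forall n, holo2 (v n)) -> lbounded r v -> ucauchy r v -> Cmod z < r ->
  has_cderiv (limf v) z (limf (fun n => cderiv (v n)) z).
Proof.
  intros Hr Hh Hb Hv Hz. pose proof (Cmod_ge_0 z) as H0.
  set (s := (Cmod z + r) / 2). set (r' := (s + r) / 2).
  assert (Hs : Cmod z < s < r' /\ r' < r) by (unfold r', s; lra).
  destruct (Hb r') as [M HM]. lra.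
  apply (has_cderiv_quadratic _ _ _ (s - Cmod z) (M * (r' * (/ (r' - s)) ^ 3))). lra.
  intros h Hh'.
  assert (Hzh : Cmod (z + h) <= s) by (eapply Rle_trans; [apply Cmod_triangle|lra]).
  apply (Clim_bound (fun n => v n (z + h)%C - v n z - cderiv (v n) z * h)%C).
  - apply Clim_minus. apply Clim_minus; apply (limf_correct r); try assumption; lra.
    apply (Clim_mult_const (fun n => cderiv (v n) z)).
    apply (limf_correct r (fun n => cderiv (v n))); [|exact Hz].
    apply ucauchy_cderiv; assumption.
  - intros n. apply cderiv_taylor; try lra; try assumption. apply Hh.
    intros t. apply HM. rewrite Cmod_zeta; lra.
Qed.

Lemma limf_bound (r : R) (v : nat -> C -> C) (M : R) (z : C) :
  ucauchy r v -> Cmod z < r -> (forall n, Cmod (v n z) <= M) -> Cmod (limf v z) <= M.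
Proof.
  intros Hv Hz HM. apply (Clim_bound (fun n => v n z)). apply (limf_correct r); assumption. exact HM.
Qed.

(** For analytic [h], the k-th Taylor coefficient at 0 as a Cauchy integral. *)
Definition coef (r : R) (h : C -> C) (k : nat) : C :=
  cmean (fun t => h (zeta r t) * (/ zeta r t) ^ k)%C.

(** The integral form of the Taylor remainder after the terms of degree below [k], coming from the
    truncated geometric series of the Cauchy kernel. *)
Definition remainder (r : R) (h : C -> C) (k : nat) (z : C) : C :=
  cmean (fun t => h (zeta r t) * ((z * / zeta r t) ^ k * (zeta r t * / (zeta r t - z))))%C.

Lemma ccurve_zeta_inv (r : R) : 0 < r -> ccurve (fun t => / zeta r t)%C.
Proof.
  intros Hr. apply ccurve_inv; [|apply ccurve_zeta]. intros t.
  apply Cmod_pos_neq. rewrite Cmod_zeta; lra.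
Qed.

Lemma coef_bound (r : R) (h : C -> C) (k : nat) (M : R) :
  0 < r < 1 -> analytic_on_disk h -> (forall t, Cmod (h (zeta r t)) <= M) ->
  Cmod (coef r h k) <= M * (/ r) ^ k.
Proof.
  intros Hr Hh HM. apply Cmod_cmean_bound.
  - apply ccurve_mult. apply analytic_circle; [exact Hh|lra]. apply ccurve_pow, ccurve_zeta_inv. lra.
  - intros t. rewrite Cmod_mult, Cmod_pow, Cmod_inv.
    2:{ apply Cmod_pos_neq. rewrite Cmod_zeta; lra. }
    rewrite Cmod_zeta by lra. apply Rmult_le_compat_r; [|apply HM].
    apply pow_le. left. apply Rinv_0_lt_compat. lra.
Qed.

Lemma ccurve_remainder (r : R) (h : C -> C) (k : nat) (z : C) :
  0 < r < 1 -> analytic_on_disk h -> Cmod z < r ->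
  ccurve (fun t => h (zeta r t) * ((z * / zeta r t) ^ k * (zeta r t * / (zeta r t - z))))%C.
Proof.
  intros Hr Hh Hz. apply ccurve_mult. apply analytic_circle; [exact Hh|lra].
  apply ccurve_mult. apply ccurve_pow, ccurve_mult. apply ccurve_const. apply ccurve_zeta_inv; lra.
  apply ccurve_mult. apply ccurve_zeta. apply ccurve_kernel, Hz.
Qed.

Lemma remainder_0 (r : R) (h : C -> C) (z : C) :
  0 < r < 1 -> holo2 h -> Cmod z < r -> remainder r h 0 z = h z.
Proof.
  intros Hr Hh Hz. rewrite (cauchy_formula h (cderiv h) 1 r z (holo2_holo_on h Hh)) by lra.
  apply cmean_ext. intros t. simpl. ring.
Qed.

(** One step of the geometric series: zeta / (zeta - z) = 1 + (z / zeta) zeta / (zeta - z). *)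
Lemma remainder_S (r : R) (h : C -> C) (k : nat) (z : C) :
  0 < r < 1 -> analytic_on_disk h -> Cmod z < r ->
  remainder r h k z = (z ^ k * coef r h k + remainder r h (S k) z)%C.
Proof.
  intros Hr Hh Hz.
  assert (C1 : ccurve (fun t => h (zeta r t) * (/ zeta r t) ^ k)%C).
  { apply ccurve_mult. apply analytic_circle; [exact Hh|lra]. apply ccurve_pow, ccurve_zeta_inv. lra. }
  unfold coef. rewrite <- cmean_scal by exact C1. unfold remainder.
  rewrite <- cmean_plus.
  - apply cmean_ext. intros t.
    assert (Hz0 : zeta r t <> 0) by (apply Cmod_pos_neq; rewrite Cmod_zeta; lra).
    pose proof (zeta_minus_neq z r t Hz) as Hn.
    rewrite Cpow_S, Cpow_mult_l. field. split; assumption.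
  - apply ccurve_mult. apply ccurve_const. exact C1.
  - apply ccurve_remainder; assumption.
Qed.

Lemma remainder_bound (r : R) (h : C -> C) (k : nat) (z : C) (M s : R) :
  0 < r < 1 -> analytic_on_disk h -> (forall t, Cmod (h (zeta r t)) <= M) ->
  s < r -> Cmod z <= s -> Cmod (remainder r h k z) <= M * ((s * / r) ^ k * (r * / (r - s))).
Proof.
  intros Hr Hh HM Hs Hz. pose proof (Cmod_ge_0 z) as H0.
  assert (Hir : 0 < / r) by (apply Rinv_0_lt_compat; lra).
  assert (Hirs : 0 < / (r - s)) by (apply Rinv_0_lt_compat; lra).
  apply Cmod_cmean_bound.
  - apply ccurve_remainder; try assumption. lra.
  - intros t. rewrite !Cmod_mult, Cmod_pow, Cmod_mult.
    assert (E : Cmod (/ zeta r t) = / r).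
    { rewrite Cmod_inv, Cmod_zeta. reflexivity. lra. apply Cmod_pos_neq. rewrite Cmod_zeta; lra. }
    rewrite E, Cmod_zeta by lra.
    assert (A1 : 0 <= Cmod z * / r) by (apply Rmult_le_pos; lra).
    apply Rmult_le_compat. apply Cmod_ge_0.
    { apply Rmult_le_pos. apply pow_le, A1. apply Rmult_le_pos. lra. apply Cmod_ge_0. }
    apply HM.
    apply Rmult_le_compat. apply pow_le, A1. apply Rmult_le_pos. lra. apply Cmod_ge_0.
    apply pow_incr. split. exact A1. apply Rmult_le_compat_r; lra.
    apply Rmult_le_compat_l. lra. apply Cmod_zeta_inv; lra.
Qed.

(** The k-th Taylor coefficients are bounded in [n] for each [k], so a diagonal subsequence makes
    all of them converge. On |z| <= s < r the remainders are O((s/r)^k) uniformly in [n], and what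
    is left is a polynomial with convergent coefficients. *)
Lemma montel (r M : R) (h : nat -> C -> C) :
  0 < r < 1 -> (forall n, holo2 (h n)) -> (forall n t, Cmod (h n (zeta r t)) <= M) ->
  exists s, incr s /\ ucauchy r (fun n => h (s n)).
Proof.
  intros Hr Hh HM.
  assert (HM0 : 0 <= M) by (eapply Rle_trans; [apply Cmod_ge_0|apply (HM O 0)]).
  destruct (diagonal_subseq (fun k n => coef r (h n) k) (fun k => M * (/ r) ^ k)) as [sub [Hsub Hlim]].
  { intros k n. apply coef_bound. exact Hr. exact (proj1 (Hh n)). apply HM. }
  exists sub. split. exact Hsub.
  intros s0 eps Hs0 He.
  set (s := Rmax s0 0).
  assert (Hs : 0 <= s < r). { unfold s. split. apply Rmax_r. apply Rmax_lub_lt; lra. }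
  assert (Hq : 0 <= s * / r < 1).
  { assert (0 < / r) by (apply Rinv_0_lt_compat; lra). split. apply Rmult_le_pos; lra.
    apply (Rmult_lt_reg_r r). lra. rewrite Rmult_assoc, Rinv_l; lra. }
  set (Q := M * (r * / (r - s)) + 1).
  assert (HQ : 0 < Q).
  { assert (0 < / (r - s)) by (apply Rinv_0_lt_compat; lra). unfold Q.
    assert (0 <= M * (r * / (r - s))). apply Rmult_le_pos. lra. apply Rmult_le_pos; lra. lra. }
  (* The budget: two remainders of eps / 4 each, and eps / 2 for the Taylor polynomials. *)
  assert (Hk : exists k, (s * / r) ^ k * Q <= eps / 4).
  { assert (Hy : 0 < eps / 4 / Q) by (repeat apply Rdiv_lt_0_compat; lra).
    destruct (pow_lt_1_zero (s * / r)) with (y := eps / 4 / Q) as [k Hk].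
    rewrite Rabs_pos_eq; lra. exact Hy.
    exists k. specialize (Hk k (le_n k)). rewrite Rabs_pos_eq in Hk by (apply pow_le; lra).
    apply (Rmult_lt_compat_r Q) in Hk; [|exact HQ].
    replace (eps / 4 / Q * Q) with (eps / 4) in Hk by (field; lra). lra. }
  destruct Hk as [k Hk].
  (* The function minus its remainder is the Taylor polynomial of degree below [j]; each induction
     step adds one convergent coefficient, with |z|^j <= 1. *)
  assert (Hpart : forall j e, 0 < e -> exists N, forall n m z, (N <= n)%nat -> (N <= m)%nat -> Cmod z <= s ->
     Cmod ((h (sub n) z - remainder r (h (sub n)) j z) - (h (sub m) z - remainder r (h (sub m)) j z)) <= e).
  { induction j as [|j IH]; intros e He'.
    - exists O. intros n m z _ _ Hz. rewrite !remainder_0 by (try exact (Hh _); lra).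
      replace (h (sub n) z - h (sub n) z - (h (sub m) z - h (sub m) z))%C with (RtoC 0) by ring.
      rewrite Cmod_0. lra.
    - destruct (IH (e / 3)) as [N1 H1]. lra.
      destruct (Hlim j) as [l Hl]. destruct (Hl (e / 3)) as [N2 H2]. lra.
      exists (max N1 N2). intros n m z Hn Hm Hz.
      specialize (H1 n m z ltac:(lia) ltac:(lia) Hz).
      assert (A1 := H2 n ltac:(lia)). assert (A2 := H2 m ltac:(lia)). simpl in A1, A2.
      rewrite (remainder_S r (h (sub n)) j z) in H1 by (try exact (proj1 (Hh _)); lra).
      rewrite (remainder_S r (h (sub m)) j z) in H1 by (try exact (proj1 (Hh _)); lra).
      set (cn := coef r (h (sub n)) j) in *. set (cm := coef r (h (sub m)) j) in *.
      set (Rn := remainder r (h (sub n)) (S j) z) in *. set (Rm := remainder r (h (sub m)) (S j) z) in *.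
      replace (h (sub n) z - Rn - (h (sub m) z - Rm))%C with
        ((h (sub n) z - (z ^ j * cn + Rn) - (h (sub m) z - (z ^ j * cm + Rm))) + z ^ j * ((cn - l) - (cm - l)))%C by ring.
      eapply Rle_trans. apply Cmod_triangle. rewrite Cmod_mult, Cmod_pow.
      assert (A3 : Cmod z ^ j <= 1).
      { rewrite <- (pow1 j). apply pow_incr. split. apply Cmod_ge_0. lra. }
      assert (A4 : Cmod ((cn - l) - (cm - l)) <= 2 * (e / 3)).
      { eapply Rle_trans. apply Cmod_minus_triangle. lra. }
      pose proof (Cmod_ge_0 ((cn - l) - (cm - l))).
      assert (0 <= Cmod z ^ j) by (apply pow_le, Cmod_ge_0). nra. }
  destruct (Hpart k (eps / 2)) as [N HN]. lra.
  exists N. intros n m z Hn Hm Hz0.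
  assert (Hz : Cmod z <= s) by (eapply Rle_trans; [exact Hz0|apply Rmax_l]).
  specialize (HN n m z Hn Hm Hz).
  assert (HR : forall n, Cmod (remainder r (h (sub n)) k z) <= eps / 4).
  { intros i. eapply Rle_trans. apply (remainder_bound r _ k z M s). exact Hr. exact (proj1 (Hh (sub i))). apply HM. lra. exact Hz.
    eapply Rle_trans; [|exact Hk]. assert (0 <= (s * / r) ^ k) by (apply pow_le; lra). unfold Q. nra. }
  pose proof (HR n) as Rn. pose proof (HR m) as Rm.
  set (a := remainder r (h (sub n)) k z) in *. set (b := remainder r (h (sub m)) k z) in *.
  replace (h (sub n) z - h (sub m) z)%C with
    ((h (sub n) z - a - (h (sub m) z - b)) + (a - b))%C by ring.
  eapply Rle_trans. apply Cmod_triangle. pose proof (Cmod_minus_triangle a b). lra.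
Qed.

(** * Sufficiency: composition with phi when its image is relatively compact *)

(** The chain rule gives |(U o phi)'| <= M |phi'| pointwise, and the means inherit this. [U'']
    enters because [in_Hp] requires (U o phi)' to be analytic. The lemma serves three times: for f'
    itself, for the limit function, and for the difference that must tend to 0. *)
Lemma comp_Sp (p r rho M N : R) (phi U U' U'' : C -> C) :
  0 < p -> rho < r -> 0 <= M -> 0 <= N ->
  holo2 phi -> (forall z, in_disk z -> Cmod (phi z) <= rho) ->
  mean_bound p (cderiv phi) (rpow N p) ->
  (forall w, Cmod w < r -> has_cderiv U w (U' w)) ->
  (forall w, Cmod w < r -> has_cderiv U' w (U'' w)) ->
  (forall w, Cmod w <= rho -> Cmod (U' w) <= M) ->
  in_Sp p (fun z => U (phi z)) /\ Hp_norm p (cderiv (fun z => U (phi z))) <= M * N.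
Proof.
  intros Hp Hr HM HN Hphi Hrho Hb HU HU' HUM.
  assert (H1 : forall z, in_disk z -> has_cderiv (fun z => U (phi z)) z (cderiv phi z * U' (phi z))%C).
  { intros z Hz. apply (has_cderiv_comp U phi). apply HU. specialize (Hrho z Hz). lra.
    apply cderiv_correct, Hphi, Hz. }
  assert (H2 : analytic_on_disk (cderiv (fun z => U (phi z)))).
  { apply (analytic_ext (fun z => cderiv phi z * U' (phi z))%C).
    - intros z Hz. symmetry. apply cderiv_unique, H1, Hz.
    - intros z Hz. eexists. apply has_cderiv_mult.
      + apply cderiv_correct, Hphi, Hz.
      + apply (has_cderiv_comp U' phi). apply HU'. specialize (Hrho z Hz). lra.
        apply cderiv_correct, Hphi, Hz. }
  destruct (mean_bound_Hp p (cderiv (fun z => U (phi z))) (M * N) Hp) as [H3 H4].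
  - apply Rmult_le_pos; assumption.
  - exact H2.
  - intros s Hs. rewrite rpow_mult by assumption.
    assert (Hc := rcont_mean_p p (cderiv phi) s Hp (proj2 Hphi) ltac:(lra)).
    apply Rle_trans with (rpow M p * mean_p p (cderiv phi) s).
    + rewrite !mean_p_rmean, <- rmean_scal by exact Hc.
      apply rmean_le.
      * apply rcont_mean_p; [exact Hp|exact H2|lra].
      * apply rcont_mult. apply rcont_const. exact Hc.
      * intros t.
        assert (Hd : in_disk (zeta s t)) by (unfold in_disk; rewrite Cmod_zeta; lra).
        rewrite (cderiv_unique _ _ _ (H1 _ Hd)), Cmod_mult.
        rewrite <- rpow_mult by (try assumption; apply Cmod_ge_0).
        apply rpow_le. lra. rewrite Rmult_comm. apply Rmult_le_compat_r. apply Cmod_ge_0.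
        apply HUM, Hrho, Hd.
    + apply Rmult_le_compat_l. apply rpow_nonneg. apply Hb, Hs.
  - split; [|exact H4]. split; [|exact H3]. intros z Hz. eexists. apply H1, Hz.
Qed.

Lemma Sp_lbounded (p M : R) (fs : nat -> C -> C) :
  1 < p -> (forall n, in_Sp p (fs n) /\ Sp_norm p (fs n) <= M) ->
  lbounded 1 (fun n => cderiv (fs n)).
Proof.
  intros Hp Hfs s Hs.
  assert (HM : forall n, Hp_norm p (cderiv (fs n)) <= M).
  { intros n. destruct (Hfs n) as [_ H]. unfold Sp_norm in H. pose proof (Cmod_ge_0 (fs n 0%C)). lra. }
  assert (HM0 : 0 <= M) by (eapply Rle_trans; [apply (Hp_norm_nonneg p (cderiv (fs O)))|apply HM]).
  exists (5 * (M + 1) * Rpower (1 - s) (- / p)). intros n z Hz.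
  eapply Rle_trans.
  - apply (growth p (cderiv (fs n)) (M + 1) z Hp).
    + apply holo2_cderiv, (in_Sp_holo2 p), Hfs.
    + lra.
    + apply in_Hp_mean_bound. lra. apply (proj1 (Hfs n)). specialize (HM n). lra.
    + unfold in_disk. lra.
  - apply Rmult_le_compat_l. lra. rewrite !Rpower_Ropp.
    apply Rinv_le_contravar. apply exp_pos.
    apply Rle_Rpower_l. left. apply Rinv_0_lt_compat. lra. lra.
Qed.

Lemma cderiv_holo2 (f : C -> C) (z : C) : holo2 f -> in_disk z -> has_cderiv f z (cderiv f z).
Proof. intros Hf Hz. apply cderiv_correct, Hf, Hz. Qed.

Lemma D_op_Sp (p rho : R) (phi f : C -> C) :
  1 < p -> rho < 1 -> (forall z, in_disk z -> Cmod (phi z) <= rho) -> in_Sp p phi ->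
  in_Sp p f -> in_Sp p (D_op phi f).
Proof.
  intros Hp Hrho Hb Hphi Hf.
  assert (Hu : holo2 (cderiv f)) by (apply holo2_cderiv, (in_Sp_holo2 p), Hf).
  assert (Hu' := holo2_cderiv _ Hu).
  (* A constant sequence lets the estimates for families apply to a single function. *)
  assert (Hl : lbounded 1 (fun _ : nat => cderiv f)).
  { apply (Sp_lbounded p (Sp_norm p f) (fun _ => f) Hp). intros _. split. exact Hf. lra. }
  assert (Hl' := lbounded_cderiv 1 _ ltac:(lra) (fun _ => Hu) Hl).
  destruct (Hl' rho Hrho) as [M HM].
  assert (HM0 : 0 <= M).
  { eapply Rle_trans; [apply Cmod_ge_0|apply (HM O (phi 0%C))].
    apply Hb. unfold in_disk. rewrite Cmod_0. lra. }
  apply (comp_Sp p 1 rho M (Hp_norm p (cderiv phi)) phi (cderiv f) (cderiv (cderiv f))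
    (cderiv (cderiv (cderiv f)))); try assumption; try lra.
  - apply Hp_norm_nonneg.
  - apply (in_Sp_holo2 p), Hphi.
  - apply in_Hp_mean_bound. lra. apply Hphi. lra.
  - intros w Hw. apply cderiv_holo2; assumption.
  - intros w Hw. apply cderiv_holo2; assumption.
  - apply (HM O).
Qed.

Lemma sup_norm_compact (p : R) (phi : C -> C) :
  1 < p -> in_Sp p phi -> Rbar_lt (sup_norm phi) 1 -> compact_D_Sp p phi.
Proof.
  intros Hp Hphi Hsup.
  assert (H0d : in_disk 0%C) by (unfold in_disk; rewrite Cmod_0; lra).
  assert (Hex : exists rho, rho < 1 /\ forall z, in_disk z -> Cmod (phi z) <= rho).
  { destruct (Lub_Rbar_correct (fun x => exists z, in_disk z /\ x = Cmod (phi z))) as [Hub _].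
    fold (sup_norm phi) in Hub.
    assert (H : forall z, in_disk z -> Rbar_le (Cmod (phi z)) (sup_norm phi)).
    { intros z Hz. apply Hub. exists z. auto. }
    assert (H1 := H 0%C H0d).
    destruct (sup_norm phi) as [s| |]; simpl in Hsup, H1; try contradiction.
    exists s. split. exact Hsup. exact H. }
  destruct Hex as [rho [Hrho Hb]].
  split. { intros f Hf. apply (D_op_Sp p rho); assumption. }
  intros fs M Hfs.
  assert (Hrho0 : 0 <= rho) by (eapply Rle_trans; [apply Cmod_ge_0|apply (Hb 0%C H0d)]).
  (* The gap between [rho] and [r] leaves room for Cauchy estimates, which carry uniform convergence
     over to the derivatives on |w| <= rho. *)
  set (r := (1 + rho) / 2). assert (Hr : rho < r < 1) by (unfold r; lra).
  set (h := fun n => cderiv (fs n)).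
  assert (Hh : forall n, holo2 (h n)) by (intros n; apply holo2_cderiv, (in_Sp_holo2 p), Hfs).
  assert (Hl : lbounded 1 h) by (apply (Sp_lbounded p M fs Hp Hfs)).
  destruct (Hl r) as [B HB]. lra.
  destruct (montel r B h) as [sub [Hsub Huc]]. lra. exact Hh.
  { intros n t. apply HB. rewrite Cmod_zeta; lra. }
  set (v := fun n => h (sub n)) in *.
  assert (Hv : forall n, holo2 (v n)) by (intros n; apply Hh).
  assert (Hv1 : forall n, holo2 (cderiv (v n))) by (intros n; apply holo2_cderiv, Hv).
  assert (Hlv : lbounded r v).
  { intros s Hs. destruct (Hl s) as [B' HB']. lra. exists B'. intros n z Hz. apply HB', Hz. }
  assert (Hr1 : 0 < r <= 1) by lra.
  assert (Hlv1 := lbounded_cderiv r v Hr1 Hv Hlv).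
  assert (Huc1 := ucauchy_cderiv r v Hr1 Hv Huc).
  assert (HU : forall w, Cmod w < r -> has_cderiv (limf v) w (limf (fun n => cderiv (v n)) w)).
  { intros w Hw. apply (limf_cderiv r); assumption. }
  assert (HU1 : forall w, Cmod w < r -> has_cderiv (limf (fun n => cderiv (v n))) w
     (limf (fun n => cderiv (cderiv (v n))) w)).
  { intros w Hw. apply (limf_cderiv r (fun n => cderiv (v n))); assumption. }
  set (N := Hp_norm p (cderiv phi)).
  assert (HN : 0 <= N) by apply Hp_norm_nonneg.
  assert (Hmb : mean_bound p (cderiv phi) (rpow N p)).
  { apply in_Hp_mean_bound. lra. apply Hphi. unfold N. lra. }
  assert (Hphi2 := in_Sp_holo2 _ _ Hphi).
  exists sub, (fun z => limf v (phi z)). split. exact Hsub. split.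
  - destruct (Hlv1 rho) as [B1 HB1]. lra.
    assert (HB10 : 0 <= B1) by (eapply Rle_trans; [apply Cmod_ge_0|apply (HB1 O (phi 0%C)), Hb, H0d]).
    apply (comp_Sp p r rho B1 N phi (limf v) (limf (fun n => cderiv (v n)))
      (limf (fun n => cderiv (cderiv (v n))))); try assumption; try lra.
    intros w Hw. apply (limf_bound r (fun n => cderiv (v n))). exact Huc1. lra. intros n. apply HB1, Hw.
  - apply is_lim_seq_spec. intros [eps He]. simpl.
    (* The value at 0 costs at most e and the H^p norm at most e N; [N + 2] instead of [N + 1] makes
       the final inequality strict. *)
    set (e := eps / (N + 2)). assert (He' : 0 < e) by (apply Rdiv_lt_0_compat; lra).
    destruct (limf_uniform r v rho e Huc) as [N1 H1]; try lra.
    destruct (limf_uniform r _ rho e Huc1) as [N2 H2]; try lra.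
    exists (max N1 N2). intros k Hk.
    (* The composition estimate is applied to U = v_k - lim v, whose derivative is at most e on |w|
       <= rho. *)
    assert (Hnorm : Hp_norm p (cderiv (fun z => D_op phi (fs (sub k)) z - limf v (phi z))%C) <= e * N).
    { apply (comp_Sp p r rho e N phi (fun w => v k w - limf v w)%C
        (fun w => cderiv (v k) w - limf (fun n => cderiv (v n)) w)%C
        (fun w => cderiv (cderiv (v k)) w - limf (fun n => cderiv (cderiv (v n))) w)%C); try assumption; try lra.
      - intros w Hw. apply has_cderiv_minus; [|apply HU, Hw].
        apply cderiv_holo2. apply Hv. unfold in_disk; lra.
      - intros w Hw. apply has_cderiv_minus; [|apply HU1, Hw].
        apply cderiv_holo2. apply Hv1. unfold in_disk; lra.
      - intros w Hw. apply H2; [lia|exact Hw]. }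
    assert (Hval : Cmod (D_op phi (fs (sub k)) 0%C - limf v (phi 0%C)) <= e).
    { apply (H1 k (phi 0%C)). lia. apply Hb, H0d. }
    assert (Hen : e * (N + 2) = eps) by (unfold e; field; lra).
    unfold Sp_norm. rewrite Rminus_0_r.
    pose proof (Hp_norm_nonneg p (cderiv (fun z => D_op phi (fs (sub k)) z - limf v (phi z))%C)) as P1.
    pose proof (Cmod_ge_0 (D_op phi (fs (sub k)) 0%C - limf v (phi 0%C))) as P2.
    rewrite Rabs_pos_eq by lra. nra.
Qed.

Theorem theorem3p6 (p : R) (phi : C -> C) :
  1 < p -> self_map phi -> in_Sp p phi ->
  (compact_D_Sp p phi <-> Rbar_lt (sup_norm phi) (Finite 1)).
Proof.
  intros Hp Hself Hphi. split.
  - apply compact_sup_norm; assumption.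
  - apply sup_norm_compact; assumption.
Qed.
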